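(* Let $F_n = J_2(f_n)$ with $f_n \in \ell_0^2(\mathbb{N})^{\circ 2}$ and assume that $\mathbb{E} [F_n^2 ]= 1$ for all $n\in\mathbb{N}$. A necessary condition for the convergence of the distribution of $F_n$ to the standard normal distribution (as $n\to\infty$) is that $$2\|f_n\|_{\ell^4(\mathbb{N})^{\otimes 2}}^4 + 3\Big( \|( f_n \star_1^1 f_n ) \mathbf{1}_{\Delta_2}\|_{\ell^2(\mathbb{N})^{\otimes 2}}^2 - \|( f_n \star_1^1 f_n ) \mathbf{1}_{\Delta_2^c}\|_{\ell^2(\mathbb{N})^{\otimes 2}}^2 \Big) \longrightarrow 0,\qquad\text{as } n\to\infty.$$
   Context: $(X_n)_{n\in\mathbb{N}}$ is a Rademacher sequence: i.i.d. with $P(X_n=\pm1)=\frac12$. $\Delta_2=\{(i,j)\in\mathbb{N}^2:i\ne j\}$ and $\Delta_2^c=\{(i,i):i\in\mathbb{N}\}$. $\ell_0^2(\mathbb{N})^{\circ 2}$ is the set of symmetric square-summable functions on $\mathbb{N}^2$ vanishing on $\Delta_2^c$. For $f\in\ell_0^2(\mathbb{N})^{\circ 2}$: $J_2(f)=2\sum_{1\le i<j<\infty}f(i,j)X_iX_j$, $(f\star_1^1f)(i,j)=\sum_{a\in\mathbb{N}}f(i,a)f(j,a)$, and $\|g\|_{\ell^p(\mathbb{N})^{\otimes2}}^p=\sum_{i,j\in\mathbb{N}}|g(i,j)|^p$. *)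

(* Defs.v *)
From HB Require Import structures.
From mathcomp Require Import all_boot all_order all_algebra finmap.
From mathcomp Require Import all_classical all_reals all_analysis.

Set Implicit Arguments.
Unset Strict Implicit.
Unset Printing Implicit Defensive.

Import Order.TTheory GRing.Theory Num.Theory.
Import numFieldNormedType.Exports.

Local Open Scope classical_set_scope.
Local Open Scope ring_scope.

Definition Delta2 : set (nat * nat) := [set p | p.1 <> p.2].

Section probability_notions.
Context (d : measure_display) (T : measurableType d) (R : realType).
Variable P : probability T R.

Definition mutually_independent (X : nat -> {RV P >-> R}) : Prop :=
  forall (J : {fset nat}) (A : nat -> set R),
    (forall i, i \in J -> measurable (A i)) ->
    P (\bigcap_(i in [set` J]) (X i @^-1` A i)) =
    (\prod_(i <- J) P (X i @^-1` A i))%E.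

(* The two point masses determine the law of each X n, so that "identically
   distributed" needs no separate clause. *)
Definition rademacher_sequence (X : nat -> {RV P >-> R}) : Prop :=
  mutually_independent X /\
  (forall n, P (X n @^-1` [set 1]) = (2^-1)%:E /\
             P (X n @^-1` [set -1]) = (2^-1)%:E).

Definition J2_partial (X : nat -> {RV P >-> R}) (f : nat * nat -> R)
    (N : nat) (w : T) : R :=
  2 * \sum_(0 <= j < N) \sum_(0 <= i < j) f (i, j) * X i w * X j w.

(* F is (a version of) the sum of the infinite series J_2(f), understood in
   L^2(P).  For square-summable f and a Rademacher sequence X the summands are
   orthogonal, so the series converges unconditionally: F exists, is unique
   up to P-a.s. equality, and does not depend on the exhaustion chosen. *)
Definition is_J2 (X : nat -> {RV P >-> R}) (f : nat * nat -> R)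
    (F : {RV P >-> R}) : Prop :=
  ('E_P[(fun w => (F w - J2_partial X f N w) ^+ 2)%R] @[N --> \oo] --> 0)%E.

Definition converges_in_law (F : nat -> {RV P >-> R})
    (nu : probability (measurableTypeR R) R) : Prop :=
  forall h : R -> R, continuous h -> (exists M : R, forall x, `|h x| <= M) ->
    ('E_P[h \o F n] @[n --> \oo] --> \int[nu]_x (h x)%:E)%E.

End probability_notions.

Section kernels.
Context (R : realType).
Implicit Types f g : nat * nat -> R.

Definition l20_sym f : Prop :=
  [/\ forall i j, f (i, j) = f (j, i),
      summable [set: nat * nat] (fun p => (f p ^+ 2)%:E)
    & forall i, f (i, i) = 0].

(* For square-summable f the series converges absolutely (Cauchy-Schwarz). *)
Definition star11 f : nat * nat -> R :=
  fun p => limn [series f (p.1, a) * f (p.2, a)]_a.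

Definition lpnorm (p : nat) g : \bar R :=
  ((\esum_(x in [set: nat * nat]) (`|g x| ^+ p)%:E) `^ (p%:R^-1))%E.

End kernels.

(* Main.v *)
(* With [G_N] the truncation of [J_2(f)] to the first [N] signs, one has exactly
   [E G_N^4 = 3 (E G_N^2)^2 + 16 q_N], where [q_N] is the truncated version of the
   quantity in the theorem (induction on [N], splitting off the last sign).
   Since [E G_N^2 -> 1] and [q_N -> q] (Tannery's theorem), it suffices to know
   that fourth moments pass to the limit along the convergence in law.  This
   follows from the uniform bound on [E G_N^6] given by hypercontractivity, by
   testing against the bounded continuous functions [min(|x|, m)^4], and from
   the value 3 of the fourth moment of the normal law. *)
Require Import Defs.
From mathcomp Require Import all_boot all_order all_algebra finmap.
From mathcomp Require Import all_classical all_reals all_analysis.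
From mathcomp Require Import measurable_realfun ring lra.
Import Order.TTheory GRing.Theory Num.Theory.
Import numFieldNormedType.Exports.
Local Open Scope classical_set_scope.
Local Open Scope ring_scope.
Set Implicit Arguments.
Unset Strict Implicit.
Unset Printing Implicit Defensive.

(** * Moments of quadratic forms in signs *)

(** [F n] is known only as an L2 limit, so its fourth and sixth moments are not directly computable.
    Polynomial moments are therefore taken on truncations, and these are compared with [F n] only
    through the bounded Lipschitz functions [trunc4 m]: with [m] and [e] fixed, the comparison costs
    a multiple of the L2 error, which vanishes as [N] grows. The resulting bound no longer involves
    [N] and is uniform in [n].

    Truncated moments are means over finitely many sign vectors; [cmean] computes them
    algebraically, and probability enters through [expectation_cmean]. The fourth-moment induction
    does not close on itself: the last sign leaves mixed moments of the quadratic form with the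
    linear form of its new column. These are computed for arbitrary vectors, because a column that
    depends on [N] cannot be carried through an induction on [N]. *)

Section cube_mean.
Context (R : realType).
Implicit Types (x l m b : nat -> R) (f : nat * nat -> R).
Implicit Types (g u v w : (nat -> R) -> R).

Definition upd x (N : nat) (c : R) : nat -> R :=
  fun i => if i == N then c else x i.

(* The coordinates [i >= N] are set to the junk value [0]. *)
Fixpoint cmean (N : nat) g : R :=
  if N is N'.+1 then
    (cmean N' (fun x => g (upd x N' 1)) + cmean N' (fun x => g (upd x N' (-1)))) / 2
  else g (fun=> 0).

Lemma eq_cmean N g u : (forall x, g x = u x) -> cmean N g = cmean N u.
Proof. by move=> /funext ->. Qed.

Lemma cmeanD N g u : cmean N (fun x => g x + u x) = cmean N g + cmean N u.
Proof. by elim: N g u => //= N IH g u; rewrite !IH; field. Qed.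

Lemma cmeanZ N c g : cmean N (fun x => c * g x) = c * cmean N g.
Proof. by elim: N g => //= N IH g; rewrite !IH; field. Qed.

Lemma cmean_cst N c : cmean N (fun=> c) = c.
Proof. by elim: N => //= N ->; field. Qed.

Lemma le_cmean N g u : (forall x, g x <= u x) -> cmean N g <= cmean N u.
Proof.
elim: N g u => [|N IH] g u gu /=; first exact: gu.
by rewrite ler_pM2r// lerD// IH.
Qed.

(** The induction step of the moment computations: averaging over the last sign cancels the terms
    odd in it, and [w] is what remains. *)
Lemma cmeanS N g w :
  (forall x, g (upd x N 1) + g (upd x N (-1)) = 2 * w x) ->
  cmean N.+1 g = cmean N w.
Proof.
by move=> gw; rewrite /= -cmeanD (eq_cmean _ gw) cmeanZ; field.
Qed.

Definition lin l (N : nat) x : R := \sum_(0 <= i < N) l i * x i.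

Definition quad f (N : nat) x : R :=
  2 * \sum_(0 <= j < N) \sum_(0 <= i < j) f (i, j) * x i * x j.

Lemma linS l N x : lin l N.+1 x = lin l N x + l N * x N.
Proof. by rewrite /lin big_nat_recr. Qed.

Lemma quadS f N x :
  quad f N.+1 x = quad f N x + 2 * lin (fun i => f (i, N)) N x * x N.
Proof.
by rewrite /quad big_nat_recr//= mulrDr /lin -[in RHS]mulrA mulr_suml.
Qed.

Lemma upd_eq x N c : upd x N c N = c.
Proof. by rewrite /upd eqxx. Qed.

Lemma upd_lt x N c i : (i < N)%N -> upd x N c i = x i.
Proof. by move=> iN; rewrite /upd ltn_eqF. Qed.

Lemma lin_upd l N x c : lin l N (upd x N c) = lin l N x.
Proof. by apply: eq_big_nat => i /andP[_ iN]; rewrite upd_lt. Qed.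

Lemma quad_upd f N x c : quad f N (upd x N c) = quad f N x.
Proof.
congr (_ * _); apply: eq_big_nat => j /andP[_ jN].
by apply: eq_big_nat => i /andP[_ ij]; rewrite !upd_lt// (ltn_trans ij).
Qed.

Lemma linS_upd l N x c : lin l N.+1 (upd x N c) = lin l N x + l N * c.
Proof. by rewrite linS lin_upd upd_eq. Qed.

Lemma quadS_upd f N x c :
  quad f N.+1 (upd x N c) = quad f N x + 2 * lin (fun i => f (i, N)) N x * c.
Proof. by rewrite quadS quad_upd lin_upd upd_eq. Qed.

Definition updE := (linS_upd, quadS_upd).

Lemma lin0 l x : lin l 0 x = 0. Proof. by rewrite /lin big_geq. Qed.

Lemma quad0 f x : quad f 0 x = 0. Proof. by rewrite /quad big_geq// mulr0. Qed.

Lemma cmean_lin2 N l m :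
  cmean N (fun x => lin l N x * lin m N x) = \sum_(0 <= i < N) l i * m i.
Proof.
elim: N => [|N IH]; first by rewrite /= !lin0 big_geq// mul0r.
rewrite (@cmeanS _ _ (fun x => lin l N x * lin m N x + l N * m N)); last first.
  by move=> x; rewrite !updE; ring.
by rewrite cmeanD IH cmean_cst big_nat_recr.
Qed.

(** The first two terms are Wick's formula; the last one corrects for the fourth moment of a sign
    being 1 instead of the Gaussian 3. *)
Lemma cmean_lin4 N l m :
  cmean N (fun x => lin l N x ^+ 2 * lin m N x ^+ 2) =
  (\sum_(0 <= i < N) l i ^+ 2) * (\sum_(0 <= i < N) m i ^+ 2)
  + 2 * (\sum_(0 <= i < N) l i * m i) ^+ 2
  - 2 * \sum_(0 <= i < N) l i ^+ 2 * m i ^+ 2.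
Proof.
elim: N => [|N IH]; first by rewrite /= !lin0 !big_geq//; ring.
rewrite (@cmeanS _ _ (fun x => lin l N x ^+ 2 * lin m N x ^+ 2
   + (m N ^+ 2 * (lin l N x * lin l N x) + (l N ^+ 2 * (lin m N x * lin m N x)
   + (4 * l N * m N * (lin l N x * lin m N x) + l N ^+ 2 * m N ^+ 2)))));
  last by move=> x; rewrite !updE; ring.
rewrite !cmeanD IH !cmeanZ !cmean_lin2 cmean_cst !big_nat_recr//=.
under [\sum_(_ <= _ < _) l _ * l _]eq_bigr do rewrite -expr2.
under [\sum_(_ <= _ < _) m _ * m _]eq_bigr do rewrite -expr2.
by ring.
Qed.

Lemma cmean_quad N f : cmean N (quad f N) = 0.
Proof.
elim: N => [|N IH]; first by rewrite /= quad0.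
by rewrite (@cmeanS _ _ (quad f N))// => x; rewrite !updE; ring.
Qed.

Lemma sum_sqrDZ N (u v : nat -> R) c :
  \sum_(0 <= a < N) (u a + c * v a) ^+ 2 =
  \sum_(0 <= a < N) u a ^+ 2 + 2 * c * \sum_(0 <= a < N) u a * v a
  + c ^+ 2 * \sum_(0 <= a < N) v a ^+ 2.
Proof.
rewrite !mulr_sumr -!big_split; apply: eq_bigr => i _ /=; ring.
Qed.

(** The name refers to the square of indices, not to squared values. *)
Definition sqsum N (g : nat * nat -> R) : R :=
  \sum_(0 <= i < N) \sum_(0 <= j < N) g (i, j).

Lemma sqsumS N (g : nat * nat -> R) :
  sqsum N.+1 g = sqsum N g + \sum_(0 <= i < N) g (i, N)
                 + \sum_(0 <= i < N) g (N, i) + g (N, N).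
Proof.
rewrite /sqsum big_nat_recr//= [X in _ + X]big_nat_recr//= addrA -[in RHS]big_split/=.
by congr (_ + _ + _); apply: eq_bigr => i _; rewrite big_nat_recr.
Qed.

Section moments.
Variable f : nat * nat -> R.
Hypothesis fsym : forall i j, f (i, j) = f (j, i).
Hypothesis fdiag : forall i, f (i, i) = 0.

Lemma cmean_quad_lin2 N l m :
  cmean N (fun x => quad f N x * (lin l N x * lin m N x)) =
  2 * sqsum N (fun p => f p * l p.1 * m p.2).
Proof.
elim: N => [|N IH]; first by rewrite /= quad0 /sqsum big_geq//; ring.
rewrite (@cmeanS _ _ (fun x => quad f N x * (lin l N x * lin m N x)
  + (l N * m N * quad f N x
  + (2 * m N * (lin (fun i => f (i, N)) N x * lin l N x)
  + 2 * l N * (lin (fun i => f (i, N)) N x * lin m N x)))));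
  last by move=> x; rewrite !updE; ring.
rewrite !cmeanD IH (cmeanZ _ (_ * _)) cmean_quad !cmeanZ !cmean_lin2 sqsumS /= fdiag.
under [\sum_(_ <= _ < _) f (N, _) * _ * _]eq_bigr do rewrite -fsym mulrAC.
by rewrite -!mulr_suml; ring.
Qed.

Lemma cmean_quad2 N : cmean N (fun x => quad f N x ^+ 2) =
  2 * sqsum N (fun p => f p ^+ 2).
Proof.
elim: N => [|N IH]; first by rewrite /= quad0 /sqsum big_geq//; ring.
pose L := lin (fun i => f (i, N)) N.
rewrite (@cmeanS _ _ (fun x => quad f N x ^+ 2 + 4 * (L x * L x)));
  last by move=> x; rewrite !updE /L; ring.
rewrite !cmeanD IH !cmeanZ !cmean_lin2 sqsumS /= fdiag.
under [\sum_(_ <= _ < _) f (N, _) ^+ 2]eq_bigr do rewrite -fsym.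
under [\sum_(_ <= _ < _) f (_, N) * _]eq_bigr do rewrite -expr2.
by ring.
Qed.

Definition rowsum N b a : R := \sum_(0 <= i < N) f (a, i) * b i.

Lemma sum_rowsum N b m :
  \sum_(0 <= a < N) rowsum N b a * m a = sqsum N (fun p => f p * m p.1 * b p.2).
Proof.
apply: eq_bigr => i _; rewrite /rowsum mulr_suml.
by apply: eq_bigr => j _ /=; ring.
Qed.

(** Without the last term this is the Gaussian value, [rowsum] being the matrix [f] applied to [b];
    the last term corrects for coinciding indices of [f] and [b]. *)
Lemma cmean_quad2_lin2 N b :
  cmean N (fun x => quad f N x ^+ 2 * lin b N x ^+ 2) =
  2 * sqsum N (fun p => f p ^+ 2) * (\sum_(0 <= i < N) b i ^+ 2)
  + 8 * (\sum_(0 <= a < N) rowsum N b a ^+ 2)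
  - 8 * sqsum N (fun p => f p ^+ 2 * b p.2 ^+ 2).
Proof.
elim: N => [|N IH]; first by rewrite /= quad0 /sqsum !big_geq//; ring.
pose L := lin (fun i => f (i, N)) N.
rewrite (@cmeanS _ _ (fun x => quad f N x ^+ 2 * lin b N x ^+ 2
  + (b N ^+ 2 * quad f N x ^+ 2 + (4 * (L x ^+ 2 * lin b N x ^+ 2)
  + (4 * b N ^+ 2 * (L x * L x) + 8 * b N * (quad f N x * (L x * lin b N x)))))));
  last by move=> x; rewrite !updE /L; ring.
rewrite !cmeanD !cmeanZ IH cmean_quad2 cmean_lin4 cmean_lin2 cmean_quad_lin2.
rewrite !sqsumS /= fdiag.
have -> : \sum_(0 <= a < N.+1) rowsum N.+1 b a ^+ 2 =
    \sum_(0 <= a < N) (rowsum N b a + b N * f (a, N)) ^+ 2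
    + (\sum_(0 <= i < N) f (i, N) * b i) ^+ 2.
  rewrite big_nat_recr//=; congr (_ + _).
    by apply: eq_bigr => a _; rewrite /rowsum big_nat_recr//= [b N * _]mulrC.
  rewrite /rowsum big_nat_recr//= fdiag mul0r addr0; congr (_ ^+ _).
  by apply: eq_bigr => a _; rewrite fsym.
rewrite sum_sqrDZ sum_rowsum /=.
under [\sum_(_ <= _ < _) f (N, _) ^+ 2]eq_bigr do rewrite -fsym.
under [\sum_(_ <= _ < _) f (N, _) ^+ 2 * _]eq_bigr do rewrite -fsym.
under [\sum_(_ <= _ < _) f (_, N) * f _]eq_bigr do rewrite -expr2.
rewrite big_nat_recr//= -mulr_suml.
by ring.
Qed.

Definition gram N (p : nat * nat) : R :=
  \sum_(0 <= a < N) f (p.1, a) * f (p.2, a).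

Lemma sum_gram N b :
  sqsum N (fun p => gram N p * (b p.1 * b p.2)) =
  \sum_(0 <= a < N) rowsum N b a ^+ 2.
Proof.
rewrite /sqsum.
under eq_bigr do under eq_bigr do rewrite /gram mulr_suml.
under eq_bigr do rewrite exchange_big.
rewrite exchange_big /=; apply: eq_bigr => a _.
rewrite expr2 {1}/rowsum mulr_suml; apply: eq_bigr => i _.
rewrite /rowsum mulr_sumr; apply: eq_bigr => j _ /=.
by rewrite (fsym i) (fsym j); ring.
Qed.

Lemma sqsum_sqrD N (u v : nat * nat -> R) :
  sqsum N (fun p => (u p + v p) ^+ 2) =
  sqsum N (fun p => u p ^+ 2) + 2 * sqsum N (fun p => u p * v p)
  + sqsum N (fun p => v p ^+ 2).
Proof.
rewrite /sqsum mulr_sumr -!big_split; apply: eq_bigr => i _ /=.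
rewrite mulr_sumr -!big_split; apply: eq_bigr => j _ /=; ring.
Qed.

(** A new index adds the rank-one matrix [l i * l j] to the old block. The cross term gives the
    [rowsum] sum twice by [sum_gram], the new row and column give it once each; the rank-one part
    and the new corner each give the fourth power of the norm of [l]. *)
Lemma sqsum_gram2S N (l := fun i => f (i, N)) :
  sqsum N.+1 (fun p => gram N.+1 p ^+ 2) =
  sqsum N (fun p => gram N p ^+ 2)
  + 4 * (\sum_(0 <= a < N) rowsum N l a ^+ 2)
  + 2 * (\sum_(0 <= i < N) l i ^+ 2) ^+ 2.
Proof.
rewrite sqsumS; have lN : l N = 0 by rewrite /l fdiag.
have gramS p : gram N.+1 p = gram N p + l p.1 * l p.2 by rewrite /gram big_nat_recr.
under [sqsum N _]eq_bigr do under eq_bigr do rewrite gramS.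
rewrite -/(sqsum N (fun p => (gram N p + l p.1 * l p.2) ^+ 2)) sqsum_sqrD sum_gram.
have -> : sqsum N (fun p => (l p.1 * l p.2) ^+ 2) =
    (\sum_(0 <= i < N) l i ^+ 2) ^+ 2.
  rewrite /sqsum expr2 mulr_suml; apply: eq_bigr => i _.
  by rewrite mulr_sumr; apply: eq_bigr => j _ /=; rewrite exprMn.
have -> : gram N.+1 (N, N) = \sum_(0 <= i < N) l i ^+ 2.
  rewrite gramS /= lN mul0r addr0 /gram; apply: eq_bigr => i _ /=.
  by rewrite fsym expr2.
have E1 : \sum_(0 <= i < N) gram N.+1 (i, N) ^+ 2 =
    \sum_(0 <= a < N) rowsum N l a ^+ 2.
  apply: eq_bigr => i _; rewrite gramS /= lN mulr0 addr0.
  by congr (_ ^+ 2); apply: eq_bigr => j _ /=; rewrite /l [f (N, _)]fsym.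
have E2 : \sum_(0 <= i < N) gram N.+1 (N, i) ^+ 2 =
    \sum_(0 <= a < N) rowsum N l a ^+ 2.
  rewrite -E1; apply: eq_bigr => i _; congr (_ ^+ 2).
  by apply: eq_bigr => j _ /=; rewrite mulrC.
rewrite E1 E2; ring.
Qed.

Lemma sum_gramdiag2S N (l := fun i => f (i, N)) :
  \sum_(0 <= i < N.+1) gram N.+1 (i, i) ^+ 2 =
  \sum_(0 <= i < N) gram N (i, i) ^+ 2
  + 2 * sqsum N (fun p => f p ^+ 2 * l p.2 ^+ 2)
  + \sum_(0 <= i < N) l i ^+ 4 + (\sum_(0 <= i < N) l i ^+ 2) ^+ 2.
Proof.
have gramS p : gram N.+1 p = gram N p + l p.1 * l p.2 by rewrite /gram big_nat_recr.
have gramD M i : gram M (i, i) = \sum_(0 <= a < M) f (i, a) ^+ 2.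
  by apply: eq_bigr => a _; rewrite expr2.
rewrite big_nat_recr//=; congr (_ + _ ^+ 2); last first.
  by rewrite gramD big_nat_recr//= fdiag expr0n addr0; apply: eq_bigr => i _; rewrite fsym.
under eq_bigr do rewrite gramS /= -[X in _ + X]mul1r.
rewrite sum_sqrDZ expr1n !mul1r mulr1; congr (_ + 2 * _ + _); last first.
  by apply: eq_bigr => i _; ring.
rewrite /sqsum [RHS]exchange_big /=; apply: eq_bigr => i _.
rewrite gramD mulr_suml; apply: eq_bigr => a _.
by rewrite (fsym i); ring.
Qed.

(** Off-diagonal minus diagonal is written as the full sum minus twice the diagonal, since these are
    the sums with a recursion in [N]. The coefficient 12 is [3 * 2 ^+ 2], the variance being twice
    the sum of squares. *)
Lemma cmean_quad4 N :
  cmean N (fun x => quad f N x ^+ 4) =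
  12 * sqsum N (fun p => f p ^+ 2) ^+ 2 + 32 * sqsum N (fun p => f p ^+ 4)
  + 48 * (sqsum N (fun p => gram N p ^+ 2)
          - 2 * \sum_(0 <= i < N) gram N (i, i) ^+ 2).
Proof.
elim: N => [|N IH]; first by rewrite /= quad0 /sqsum !big_geq//; ring.
pose l i := f (i, N); pose L := lin l N.
rewrite (@cmeanS _ _ (fun x => quad f N x ^+ 4
  + (24 * (quad f N x ^+ 2 * L x ^+ 2) + 16 * (L x ^+ 2 * L x ^+ 2))));
  last by move=> x; rewrite !updE /L /l; ring.
rewrite !cmeanD !cmeanZ IH cmean_quad2_lin2 cmean_lin4.
rewrite sqsum_gram2S sum_gramdiag2S !sqsumS /= fdiag.
have fN k : \sum_(0 <= i < N) f (N, i) ^+ k = \sum_(0 <= i < N) l i ^+ k.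
  by apply: eq_bigr => i _; rewrite fsym.
have l2 : \sum_(0 <= i < N) l i * l i = \sum_(0 <= i < N) l i ^+ 2 by [].
have l4 : \sum_(0 <= i < N) l i ^+ 2 * l i ^+ 2 = \sum_(0 <= i < N) l i ^+ 4.
  by apply: eq_bigr => i _; ring.
rewrite !fN l2 l4 -/l /l.
by ring.
Qed.

End moments.

(** The constant 15 is the sixth moment of a standard Gaussian: the recursion for signs has
    coefficients no larger than those of the expanded cube on the right. *)
Lemma cmean_lin6 N l :
  cmean N (fun x => lin l N x ^+ 6) <= 15 * (\sum_(0 <= i < N) l i ^+ 2) ^+ 3.
Proof.
elim: N => [|N IH]; first by rewrite /= lin0 big_geq// !expr0n mulr0.
rewrite (@cmeanS _ _ (fun x => lin l N x ^+ 6
  + (15 * l N ^+ 2 * (lin l N x ^+ 2 * lin l N x ^+ 2)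
  + (15 * l N ^+ 4 * (lin l N x * lin l N x) + l N ^+ 6))));
  last by move=> x; rewrite !updE; ring.
rewrite !cmeanD cmean_cst !cmeanZ cmean_lin4 cmean_lin2 big_nat_recr//.
have l2 : \sum_(0 <= i < N) l i * l i = \sum_(0 <= i < N) l i ^+ 2 by [].
have s0 : 0 <= \sum_(0 <= i < N) l i ^+ 2 by apply: sumr_ge0 => i _; exact: sqr_ge0.
have r0 : 0 <= \sum_(0 <= i < N) l i ^+ 2 * l i ^+ 2.
  by apply: sumr_ge0 => i _; rewrite mulr_ge0// sqr_ge0.
rewrite l2 (exprM (l N) 2 2) (exprM (l N) 2 3).
have := sqr_ge0 (l N).
move: IH s0 r0; move: (l N ^+ 2) (\sum_(0 <= i < N) l i ^+ 2)
  (\sum_(0 <= i < N) l i ^+ 2 * l i ^+ 2) => c s r IH s0 r0 c0.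
have cr : 0 <= c * r by rewrite mulr_ge0.
have c3 : 0 <= c ^+ 3 by rewrite exprn_ge0.
have cs : 0 <= c ^+ 2 * s by rewrite mulr_ge0 ?exprn_ge0.
rewrite /=; lra.
Qed.

(* Weighted AM-GM for [15 u^2 v + 15 u v^2] with weights [t / (10 s)] and
   [t / (2 s)], which balances the two sixth moments below. *)
Lemma sixth_power_step (s t F M : R) : 0 < s -> 0 < t ->
  (F + M) ^+ 6 + (F - M) ^+ 6 <=
  2 * ((1 + t / s + 5 / 4 * (t / s) ^+ 2) * F ^+ 6
       + (1 + 500 * (s / t) ^+ 2 + 20 * (s / t)) * M ^+ 6).
Proof.
move=> s0 t0.
have -> : (F + M) ^+ 6 + (F - M) ^+ 6 = 2 * ((F ^+ 2) ^+ 3 +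
  15 * ((F ^+ 2) ^+ 2 * M ^+ 2) + 15 * (F ^+ 2 * (M ^+ 2) ^+ 2)
  + (M ^+ 2) ^+ 3) by ring.
have -> : F ^+ 6 = (F ^+ 2) ^+ 3 by ring.
have -> : M ^+ 6 = (M ^+ 2) ^+ 3 by ring.
have := sqr_ge0 F; have := sqr_ge0 M.
move: (F ^+ 2) (M ^+ 2) => u v v0 u0.
have E3 (a c : R) : 0 <= a -> 0 <= c -> 3 * (a ^+ 2 * c) <= 2 * a ^+ 3 + c ^+ 3.
  move=> a0 c0; rewrite -subr_ge0.
  have -> : 2 * a ^+ 3 + c ^+ 3 - 3 * (a ^+ 2 * c) = (a - c) ^+ 2 * (2 * a + c) by ring.
  by rewrite mulr_ge0 ?sqr_ge0// addr_ge0// mulr_ge0.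
have st0 : 0 < s / t by rewrite divr_gt0.
have ts : t / s = (s / t)^-1 by rewrite invf_div.
rewrite ts; move: (s / t) st0 => r r0.
have r1 : 0 <= r^-1 by rewrite invr_ge0 ltW.
have A : 15 * (u ^+ 2 * v) <= r^-1 * u ^+ 3 + 500 * r ^+ 2 * v ^+ 3.
  rewrite -subr_ge0 (_ : _ - _ = r^-1 / 2 *
    (2 * u ^+ 3 + (10 * r * v) ^+ 3 - 3 * (u ^+ 2 * (10 * r * v)))); last first.
    by field; rewrite gt_eqF.
  rewrite mulr_ge0 ?divr_ge0// subr_ge0 E3// mulr_ge0//.
  by rewrite mulr_ge0// ltW.
have B : 15 * (u * v ^+ 2) <= 5 / 4 * r^-1 ^+ 2 * u ^+ 3 + 20 * r * v ^+ 3.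
  rewrite -subr_ge0 (_ : _ - _ = 10 * r *
    (2 * v ^+ 3 + (r^-1 / 2 * u) ^+ 3 - 3 * (v ^+ 2 * (r^-1 / 2 * u)))); last first.
    by field; rewrite gt_eqF.
  rewrite mulr_ge0// ?mulr_ge0 ?(ltW r0)// subr_ge0 E3// mulr_ge0//.
  by rewrite divr_ge0.
lra.
Qed.

(* The strict inequality leaves room to split [s] into two positive parts in the
   induction step, even when one of the variances vanishes. *)
Lemma cmean_quad6 f : (forall i j, f (i, j) = f (j, i)) ->
  (forall i, f (i, i) = 0) ->
  forall (K : R), 15 * 250 <= K ->
  forall N (s : R), 2 * sqsum N (fun p => f p ^+ 2) < s ->
  cmean N (fun x => quad f N x ^+ 6) <= K * s ^+ 3.
Proof.
move=> fsym fdiag K hK; have K0 : 0 <= K by apply: le_trans hK; rewrite mulr_ge0.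
elim=> [|N IH] s.
  by rewrite /= quad0 /sqsum big_geq// mulr0 expr0n/= => /ltW s0; rewrite mulr_ge0// exprn_ge0.
rewrite sqsumS /= fdiag.
under [\sum_(_ <= _ < _) f (N, _) ^+ 2]eq_bigr do rewrite -fsym.
pose L := lin (fun i => f (i, N)) N.
have s20 : 0 <= sqsum N (fun p => f p ^+ 2).
  by apply: sumr_ge0 => i _; apply: sumr_ge0 => j _; exact: sqr_ge0.
have l20 : 0 <= \sum_(0 <= i < N) f (i, N) ^+ 2.
  by apply: sumr_ge0 => i _; exact: sqr_ge0.
have L6 := cmean_lin6 N (fun i => f (i, N)).
move: IH s20 l20 L6; set sig := sqsum N _; set lam := \sum_(0 <= i < N) _.
move=> IH s20 l20 L6 hs.
(* Half of the slack: [s1] and [t1] strictly exceed the variances of the old form and of [2 * L],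
   and still add up to [s]. *)
pose e := (s - 2 * sig - 4 * lam) / 2.
have e0 : 0 < e by rewrite /e; lra.
pose s1 := 2 * sig + e; pose t1 := 4 * lam + e.
have s10 : 0 < s1 by rewrite /s1; lra.
have t10 : 0 < t1 by rewrite /t1; lra.
have -> : s = s1 + t1 by rewrite /s1 /t1 /e; field.
have {}IH := IH s1 _.
pose a := 1 + t1 / s1 + 5 / 4 * (t1 / s1) ^+ 2.
pose b := 1 + 500 * (s1 / t1) ^+ 2 + 20 * (s1 / t1).
apply: (@le_trans _ _ (cmean N (fun x => a * quad f N x ^+ 6 + b * (64 * L x ^+ 6)))).
  rewrite /= -cmeanD ler_pdivrMr// mulrC -cmeanZ; apply: le_cmean => x.
  rewrite !updE mulr1 mulrN1 -/L; apply: le_trans (sixth_power_step _ _ s10 t10) _.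
  by rewrite -/a -/b; lra.
rewrite cmeanD !cmeanZ.
have st0 : 0 < s1 / t1 by rewrite divr_gt0.
have ts0 : 0 < t1 / s1 by rewrite divr_gt0.
have a0 : 0 <= a by have := sqr_ge0 (t1 / s1); rewrite /a; lra.
have b0 : 0 <= b by have := sqr_ge0 (s1 / t1); rewrite /b; lra.
apply: (@le_trans _ _ (a * (K * s1 ^+ 3) + b * (15 * t1 ^+ 3))).
  apply: lerD; apply: ler_wpM2l => //; first by apply: IH; rewrite /s1; lra.
  apply: (@le_trans _ _ (15 * (4 * lam) ^+ 3)).
    apply: (@le_trans _ _ (64 * (15 * lam ^+ 3))); last by lra.
    by rewrite ler_pM2l.
  rewrite ler_pM2l// lerXn2r ?nnegrE//; [lra|exact: ltW|by rewrite /t1; lra].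
(* Against the expansion of [K * (s1 + t1) ^+ 3], the coefficient of [s1 ^+ 2 * t1] requires
   [K + 15 * 500 <= 3 * K], which is the origin of [15 * 250]; the other coefficients ask for
   less. *)
have -> : a * (K * s1 ^+ 3) + b * (15 * t1 ^+ 3) =
   K * s1 ^+ 3 + (K + 15 * 500) * (s1 ^+ 2 * t1)
   + (5 / 4 * K + 300) * (s1 * t1 ^+ 2) + 15 * t1 ^+ 3.
  by rewrite /a /b; field; rewrite !gt_eqF.
have h0 : 0 <= (K - 15 * 250) * (s1 ^+ 2 * t1).
  by rewrite mulr_ge0 ?subr_ge0// mulr_ge0 ?sqr_ge0// ltW.
have h1 : 0 <= s1 * t1 ^+ 2 by rewrite mulr_ge0 ?sqr_ge0// ltW.
have h1' : 0 <= (K - 15 * 250) * (s1 * t1 ^+ 2) by rewrite mulr_ge0 ?subr_ge0.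
have h2 : 0 <= t1 ^+ 3 by rewrite exprn_ge0// ltW.
have h2' : 0 <= (K - 15 * 250) * t1 ^+ 3 by rewrite mulr_ge0 ?subr_ge0.
lra.
Qed.

End cube_mean.

(** * Double series *)

Section double_series.
Context (R : realType).
Implicit Types (f g : nat * nat -> R).

Lemma le_sqsum N g h : (forall p, g p <= h p) -> sqsum N g <= sqsum N h.
Proof. by move=> gh; apply: ler_sum => i _; apply: ler_sum. Qed.

Lemma sqsum_ge0 N g : (forall p, 0 <= g p) -> 0 <= sqsum N g.
Proof. by move=> g0; apply: sumr_ge0 => i _; apply: sumr_ge0. Qed.

Lemma sqsumD N g h : sqsum N (fun p => g p + h p) = sqsum N g + sqsum N h.
Proof.
by rewrite /sqsum -big_split; apply: eq_bigr => i _; rewrite -big_split.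
Qed.

Lemma sqsumZ N c g : sqsum N (fun p => c * g p) = c * sqsum N g.
Proof.
by rewrite /sqsum mulr_sumr; apply: eq_bigr => i _; rewrite mulr_sumr.
Qed.

Lemma nondecreasing_sqsum g : (forall p, 0 <= g p) ->
  nondecreasing_seq (fun N => sqsum N g).
Proof.
move=> g0; apply/nondecreasing_seqP => N; rewrite sqsumS -!addrA lerDl.
by rewrite !addr_ge0// sumr_ge0.
Qed.

Lemma is_cvg_sqsum g B : (forall p, 0 <= g p) -> (forall N, sqsum N g <= B) ->
  cvgn (fun N => sqsum N g).
Proof.
move=> g0 gB; apply: nondecreasing_is_cvgn; first exact: nondecreasing_sqsum.
by exists B => _ [N _ <-].
Qed.

Lemma cvg_sqsum N (a : nat -> nat * nat -> R) g :
  (forall p, a n p @[n --> \oo] --> g p) ->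
  sqsum N (a n) @[n --> \oo] --> sqsum N g.
Proof.
move=> ag; rewrite /sqsum.
apply: cvg_big => [|i _]; first exact: add_continuous.
apply: cvg_big => [|j _]; first exact: add_continuous.
exact: ag.
Qed.

Lemma sqsum_fsbig N g : sqsum N g = \sum_(p \in `I_N `*` `I_N) g p.
Proof.
rewrite /sqsum big_mkord (fsbig_ord _ N (fun i => \sum_(0 <= j < N) g (i, j))).
under eq_fsbigr => i _.
  rewrite big_mkord (fsbig_ord _ N (fun j => g (i, j))); over.
rewrite pair_fsbig//; apply: eq_fsbigr => -[i j] _ //.
Qed.

(** The unordered sum is a supremum over finite sets, and every finite set of pairs lies in some
    square. *)
Lemma cvg_sqsum_esum g l : (forall p, 0 <= g p) ->
  sqsum N g @[N --> \oo] --> l ->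
  (\esum_(p in [set: nat * nat]) (g p)%:E = l%:E)%E.
Proof.
move=> g0 gl.
have lE : limn (fun N => sqsum N g) = l by exact/cvg_lim.
have sE N : (\sum_(p \in `I_N `*` `I_N) (g p)%:E)%E = (sqsum N g)%:E.
  by rewrite sqsum_fsbig fsumEFin//; exact: finite_setX.
apply/eqP; rewrite eq_le; apply/andP; split.
  apply: ge_ereal_sup => _ [A [finA _] <-].
  pose N := (\max_(p <- fset_set A) maxn p.1 p.2).+1.
  apply: (@le_trans _ _ (\sum_(p \in `I_N `*` `I_N) (g p)%:E)%E).
    apply: lee_fsum_nneg_subset => //.
    - exact: finite_setX.
    - move=> p /[!inE] Ap.
      have pA : p \in fset_set A by rewrite in_fset_set// inE.
      have : (maxn p.1 p.2 <= \max_(q <- fset_set A) maxn q.1 q.2)%N.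
        exact: (leq_bigmax_seq (F := fun q => maxn q.1 q.2)) pA isT.
      by rewrite geq_max => /andP[].
    - by move=> p _; rewrite lee_fin.
  rewrite sE lee_fin -lE; apply: nondecreasing_cvgn_le.
    exact: nondecreasing_sqsum.
  by apply/cvg_ex; exists l.
rewrite -lE -EFin_lim; last by apply/cvg_ex; exists l.
apply: lime_le.
  by apply/cvg_ex; exists l%:E; apply/fine_cvgP; split=> //; near=> n.
near=> N; rewrite /= -sE; apply: esum_ge; exists (`I_N `*` `I_N) => //.
by split => //; exact: finite_setX.
Unshelve. all: by end_near. Qed.

Lemma summable_sqsum_bound f :
  summable [set: nat * nat] (fun p => (f p ^+ 2)%:E) ->
  exists B, forall N, sqsum N (fun p => f p ^+ 2) <= B.
Proof.
rewrite summableE => fin.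
exists (fine (\esum_(p in [set: nat * nat]) `|(f p ^+ 2)%:E|)%E) => N.
rewrite -lee_fin fineK//; apply: esum_ge; exists (`I_N `*` `I_N).
  by split => //; exact: finite_setX.
rewrite sqsum_fsbig -fsumEFin; last exact: finite_setX.
by apply: lee_fsum => [|p _]; [exact: finite_setX|exact: lee_abs].
Qed.

(** The entries [gram f N p] change with [N] along with the range of summation, so monotonicity does
    not suffice. Inside a fixed square [K] convergence is pointwise; outside it the tail of [b]
    dominates. *)
Lemma tannery (a : nat -> nat * nat -> R) g b B :
  (forall N p, 0 <= a N p <= b p) -> (forall p, a n p @[n --> \oo] --> g p) ->
  (forall N, sqsum N b <= B) ->
  exists2 l : R, sqsum N g @[N --> \oo] --> l & sqsum N (a N) @[N --> \oo] --> l.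
Proof.
move=> ab ag bB.
have b0 p : 0 <= b p by have /andP[] := ab 0%N p; exact: le_trans.
have gb p : 0 <= g p <= b p.
  apply/andP; split.
    by apply: (cvgr_to_ge (ag p)); near=> n; have /andP[] := ab n p.
  by apply: (cvgr_to_le (ag p)); near=> n; have /andP[] := ab n p.
have cb := is_cvg_sqsum b0 bB.
have cg : cvgn (fun N => sqsum N g).
  apply: (@is_cvg_sqsum _ B) => [p|N]; first by have /andP[] := gb p.
  by apply: le_trans (bB N); apply: le_sqsum => p; have /andP[] := gb p.
exists (limn (fun N => sqsum N g)) => //.
apply/cvgrPdist_lt => e e0.
(* One quarter for the tail of [g], one for the square [K], and two for the tail of [b], whose two
   partial sums are each compared with the limit. *)
have e4 : 0 < e / 4 by rewrite divr_gt0.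
have [K _ HK] := (cvgrPdist_lt _ _).1 cb _ e4.
have dK : sqsum K (fun p => `|a n p - g p|) @[n --> \oo] --> (0 : R).
  rewrite [X in _ --> X](_ : 0 = sqsum K (fun p => `|g p - g p|)).
    apply: (@cvg_sqsum K (fun n p => `|a n p - g p|)) => p.
    by apply: cvg_norm; apply: cvgB => //; exact: cvg_cst.
  by rewrite /sqsum big1// => i _; rewrite big1// => j _; rewrite subrr normr0.
near=> N.
have KN : (K <= N)%N by near: N; exists K.
have h1 : `|limn (fun N => sqsum N g) - sqsum N g| < e / 4.
  by near: N; exact: (cvgrPdist_lt _ _).1 cg _ e4.
have h2 : sqsum K (fun p => `|a N p - g p|) < e / 4.
  have : `|0 - sqsum K (fun p => `|a N p - g p|)| < e / 4.
    by near: N; exact: (cvgrPdist_lt _ _).1 dK _ e4.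
  by rewrite sub0r normrN; apply: le_lt_trans; exact: ler_norm.
have h3 : sqsum N b - sqsum K b < e / 4 + e / 4.
  have := HK K (leqnn K); have := HK N KN.
  by rewrite /= !ltr_norml => /andP[? ?] /andP[? ?]; lra.
have h4 : `|sqsum N (a N) - sqsum N g| <= sqsum N (fun p => `|a N p - g p|).
  rewrite -mulN1r -sqsumZ -sqsumD /sqsum.
  apply: le_trans (ler_norm_sum _ _ _) _; apply: ler_sum => i _.
  apply: le_trans (ler_norm_sum _ _ _) _; apply: ler_sum => j _.
  by rewrite mulN1r.
(* [b - |a N - g|] is nonnegative, so its square sums increase with the square. *)
have h5 : sqsum K (fun p => b p + -1 * `|a N p - g p|) <=
          sqsum N (fun p => b p + -1 * `|a N p - g p|).
  apply: nondecreasing_sqsum KN => p; rewrite mulN1r subr_ge0.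
  have /andP[? ?] := ab N p; have /andP[? ?] := gb p.
  by rewrite ler_norml; apply/andP; split; lra.
move: h5; rewrite !sqsumD !sqsumZ => h5.
have := ler_distD (sqsum N g) (limn (fun N => sqsum N g)) (sqsum N (a N)).
by move=> h6; rewrite distrC in h4; lra.
Unshelve. all: by end_near. Qed.

Lemma lpnormX (p : nat) g l : (0 < p)%N ->
  sqsum N (fun x => `|g x| ^+ p) @[N --> \oo] --> l ->
  (lpnorm p g ^+ p = l%:E)%E.
Proof.
move=> p0 gl; have gp0 x : 0 <= `|g x| ^+ p by rewrite exprn_ge0.
have l0 : 0 <= l.
  by apply: (cvgr_to_ge gl); near=> N; exact: sqsum_ge0.
rewrite /lpnorm (cvg_sqsum_esum gp0 gl) poweR_EFin -EFin_expe; congr EFin.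
by rewrite -powR_mulrn ?powR_ge0// -powRrM mulVf ?powRr1// pnatr_eq0 -lt0n.
Unshelve. all: by end_near. Qed.

(** Lagrange's identity: twice the gap between the two sides is the sum of the squares of
    [u i * v j - u j * v i]. *)
Lemma sum_mul_sqr_le N (u v : nat -> R) :
  (\sum_(0 <= i < N) u i * v i) ^+ 2 <=
  (\sum_(0 <= i < N) u i ^+ 2) * (\sum_(0 <= i < N) v i ^+ 2).
Proof.
have prod (s t : nat -> R) : sqsum N (fun p => s p.1 * t p.2) =
    (\sum_(0 <= i < N) s i) * (\sum_(0 <= i < N) t i).
  by rewrite /sqsum mulr_suml; apply: eq_bigr => i _; rewrite mulr_sumr.
have : 0 <= sqsum N (fun p => (u p.1 * v p.2 - u p.2 * v p.1) ^+ 2).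
  by apply: sqsum_ge0 => p; exact: sqr_ge0.
rewrite (_ : (fun p => _) = (fun p =>
    u p.1 ^+ 2 * v p.2 ^+ 2 + v p.1 ^+ 2 * u p.2 ^+ 2
    + -2 * ((u p.1 * v p.1) * (u p.2 * v p.2)))); last first.
  by apply/funext => p; ring.
rewrite !sqsumD sqsumZ (prod (fun i => u i ^+ 2) (fun i => v i ^+ 2)).
rewrite (prod (fun i => v i ^+ 2) (fun i => u i ^+ 2)).
by rewrite (prod (fun i => u i * v i) (fun i => u i * v i)); lra.
Qed.

(** * Convergence of the truncated contractions *)

Section contraction.
Variables (f : nat * nat -> R) (B : R).
Hypothesis fB : forall N, sqsum N (fun p => f p ^+ 2) <= B.

Let rowsq i M := \sum_(0 <= a < M) f (i, a) ^+ 2.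

Let rowsq_ge0 i M : 0 <= rowsq i M.
Proof. by apply: sumr_ge0 => a _; exact: sqr_ge0. Qed.

Let nd_rowsq i : nondecreasing_seq (rowsq i).
Proof.
by apply/nondecreasing_seqP => M; rewrite /rowsq big_nat_recr//= lerDl sqr_ge0.
Qed.

Let sum_rowsq_le N M : \sum_(0 <= i < N) rowsq i M <= B.
Proof.
apply: le_trans (fB (maxn N M)); rewrite /sqsum.
rewrite [leRHS](@big_cat_nat _ _ _ N)//= ?leq_maxl//.
apply: (@le_trans _ _ (\sum_(0 <= i < N) rowsq i (maxn N M))).
  by apply: ler_sum => i _; apply: nd_rowsq; exact: leq_maxr.
by rewrite lerDl sumr_ge0// => i _; exact: rowsq_ge0.
Qed.

Let rowsq_le i M : rowsq i M <= B.
Proof.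
apply: le_trans (sum_rowsq_le i.+1 M); rewrite big_nat_recr//= lerDr.
by rewrite sumr_ge0.
Qed.

Let row i := limn (rowsq i).

Let is_cvg_rowsq i : cvgn (rowsq i).
Proof.
apply: nondecreasing_is_cvgn => //.
by exists B => _ [M _ <-].
Qed.

Let rowsq_row i M : rowsq i M <= row i.
Proof. exact: nondecreasing_cvgn_le. Qed.

Let row_ge0 i : 0 <= row i.
Proof. exact: le_trans (rowsq_row i 0%N). Qed.

(** Together with [gram_sqr_le] this provides the dominating function that [tannery] asks for:
    [row i] is the squared norm of row [i] of [f], and these add up to at most [B]. *)
Let sqsum_row N : sqsum N (fun p => row p.1 * row p.2) <= B ^+ 2.
Proof.
have rB : \sum_(0 <= i < N) row i <= B.
  have : \sum_(0 <= i < N) rowsq i M @[M --> \oo] --> \sum_(0 <= i < N) row i.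
    apply: cvg_big => [|i _]; [exact: add_continuous|exact: is_cvg_rowsq].
  by move=> /cvgr_to_le; apply; near=> M; exact: sum_rowsq_le.
have r0 : 0 <= \sum_(0 <= i < N) row i by exact: sumr_ge0.
rewrite (_ : sqsum _ _ = (\sum_(0 <= i < N) row i) ^+ 2).
  by rewrite lerXn2r// nnegrE// (le_trans r0).
rewrite /sqsum expr2 mulr_suml; apply: eq_bigr => i _.
by rewrite mulr_sumr.
Unshelve. all: by end_near. Qed.

Let gram_sqr_le N p : gram f N p ^+ 2 <= row p.1 * row p.2.
Proof.
apply: (@le_trans _ _ (rowsq p.1 N * rowsq p.2 N)); first exact: sum_mul_sqr_le.
exact: ler_pM.
Qed.

(** Absolute convergence: the product of two entries is at most half the sum of their squares, and
    both rows are square-summable. *)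
Lemma cvg_gram p : gram f N p @[N --> \oo] --> star11 f p.
Proof.
apply: (@normed_cvg _ R^o); apply: nondecreasing_is_cvgn.
  by apply/nondecreasing_seqP => N; rewrite /= /series/= big_nat_recr//= lerDl normr_ge0.
exists B => _ [N _ <-].
apply: (@le_trans _ _ ((rowsq p.1 N + rowsq p.2 N) / 2)); last first.
  by have := rowsq_le p.1 N; have := rowsq_le p.2 N; lra.
rewrite /series /= -big_split mulr_suml; apply: ler_sum => a _ /=.
rewrite normrM -(real_normK (num_real (f (p.1, a)))) -(real_normK (num_real (f (p.2, a)))).
have := sqr_ge0 (`|f (p.1, a)| - `|f (p.2, a)|); lra.
Qed.

Lemma cvg_sqsum_gram (A : set (nat * nat)) : exists2 l : R,
  (lpnorm 2 (star11 f \* \1_A)%R ^+ 2 = l%:E)%E &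
  sqsum N (fun p => (gram f N p * \1_A p) ^+ 2) @[N --> \oo] --> l.
Proof.
have [] := @tannery (fun N p => (gram f N p * \1_A p) ^+ 2)
  (fun p => (star11 f p * \1_A p) ^+ 2) (fun p => row p.1 * row p.2) (B ^+ 2).
- move=> N p; rewrite sqr_ge0/= exprMn.
  by apply: le_trans (gram_sqr_le N p); rewrite ler_piMr ?sqr_ge0//.
- move=> p; rewrite [X in _ --> X]expr2; under eq_fun do rewrite expr2.
  by apply: cvgM; apply: cvgM; (exact: cvg_gram || exact: cvg_cst).
- exact: sqsum_row.
move=> l l1 l2; exists l => //; apply: lpnormX => //.
by under eq_fun do under [X in sqsum _ X]eq_fun do rewrite real_normK ?num_real//.
Qed.

Lemma is_cvg_sqsum4 : exists2 l : R, (lpnorm 4 f ^+ 4 = l%:E)%E &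
  sqsum N (fun p => f p ^+ 4) @[N --> \oo] --> l.
Proof.
have f4 p : `|f p| ^+ 4 = f p ^+ 4 by rewrite -normrX ger0_norm// exprn_even_ge0.
have /cvg_ex[l cl] : cvgn (fun N => sqsum N (fun p => f p ^+ 4)).
  have fle i j : f (i, j) ^+ 2 <= B.
    apply: le_trans (rowsq_le i j.+1).
    by rewrite /rowsq big_nat_recr//= lerDr rowsq_ge0.
  have B0 : 0 <= B by exact: le_trans (rowsq_le 0%N 0%N).
  apply: (@is_cvg_sqsum _ (B * B)) => [p|N]; first exact: exprn_even_ge0.
  apply: (@le_trans _ _ (B * sqsum N (fun p => f p ^+ 2))); last exact: ler_wpM2l.
  rewrite -sqsumZ; apply: le_sqsum => -[i j].
  by rewrite (exprM _ 2 2) [leLHS]expr2 ler_wpM2r ?sqr_ge0.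
exists l => //; apply: lpnormX => //.
by under eq_fun do under [X in sqsum _ X]eq_fun do rewrite f4.
Qed.

End contraction.

End double_series.

(** * Expectations over a Rademacher sequence *)

Section rademacher_expectation.
Context (d : measure_display) (T : measurableType d) (R : realType).
Variables (P : probability T R) (X : nat -> {RV P >-> R}).
Hypothesis hX : rademacher_sequence X.

Definition sign_event (J : {fset nat}) (s : nat -> R) : set T :=
  \bigcap_(i in [set` J]) (X i @^-1` [set s i]).

Lemma measurable_sign i c : measurable (X i @^-1` [set c]).
Proof. by rewrite -[X in measurable X]setTI; exact: measurable_funP. Qed.

Lemma measurable_sign_event J s : measurable (sign_event J s).
Proof.
apply: fin_bigcap_measurable => [|i _]; [exact: finite_fset|exact: measurable_sign].
Qed.

Lemma sign_eventU1 (J : {fset nat}) s N c : N \notin J ->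
  sign_event (N |` J)%fset (upd s N c) =
  sign_event J s `&` X N @^-1` [set c].
Proof.
move=> NJ; have updJ i : i \in J -> upd s N c i = s i.
  by move=> iJ; rewrite /upd; case: eqP => // iN; rewrite -iN iJ in NJ.
apply/seteqP; split=> w /=.
  move=> h; split.
    move=> i /= iJ; have /= := h i; rewrite in_fset1U iJ orbT => /(_ isT).
    by rewrite updJ.
  by have /= := h N; rewrite in_fset1U eqxx upd_eq => /(_ isT).
move=> [h hN] i /=; rewrite in_fset1U => /orP[/eqP ->|iJ]; first by rewrite upd_eq.
by rewrite updJ//; exact: h.
Qed.

Lemma probability_sign_event J s :
  (forall i, i \in J -> s i = 1 \/ s i = -1) ->
  P (sign_event J s) = (2^-1 ^+ #|` J|)%:E.
Proof.
move=> hs; case: hX => hind hlaw.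
rewrite /sign_event (hind J (fun i => [set s i])) => [|i iJ]; last exact: measurable_set1.
rewrite (eq_big_seq (fun=> (2^-1)%:E)).
  by rewrite prodEFin big_const_seq count_predT iter_mulr_1.
by move=> i iJ; have [h1 h2] := hlaw i; case: (hs i iJ) => ->; rewrite ?h1 ?h2.
Qed.

(** [X N] may take other values on a null set, which has to be discarded before splitting along its
    sign. *)
Lemma probability_not_sign N :
  P (~` (X N @^-1` [set 1] `|` X N @^-1` [set -1])) = 0%E.
Proof.
rewrite probability_setC; last by apply: measurableU; exact: measurable_sign.
have -> : P (X N @^-1` [set 1] `|` X N @^-1` [set -1]) =
    (P (X N @^-1` [set 1%R]) + P (X N @^-1` [set (-1)%R]))%E.
  apply: measureU; [exact: measurable_sign|exact: measurable_sign|].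
  by apply/seteqP; split => // w [/= -> h]; lra.
have [h1 h2] := hX.2 N.
by rewrite [X in (1 - (X + _))%E]h1 [X in (1 - (_ + X))%E]h2 -EFinD; congr EFin; field.
Qed.

(* Allowing events about the coordinates [>= N] makes the induction on [N] work:
   splitting along the sign of [X N] only enlarges [J]. *)
Lemma integral_sign_event N (g : (nat -> R) -> R) (J : {fset nat}) (s : nat -> R) :
  (forall j, j \in J -> (N <= j)%N) ->
  (forall j, j \in J -> s j = 1 \/ s j = -1) ->
  (forall x, 0 <= g x) ->
  (forall x y, (forall i, (i < N)%N -> x i = y i) -> g x = g y) ->
  (forall Y : nat -> T -> R, (forall i, measurable_fun setT (Y i)) ->
    measurable_fun setT (fun w => g (Y^~ w))) ->
  (\int[P]_(w in sign_event J s) (g (fun i => X i w))%:E =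
   (2^-1 ^+ #|` J| * cmean N g)%:E)%E.
Proof.
elim: N g J s => [|N IH] g J s NJ hs g0 gloc gmeas.
  (* No coordinate is left, so [g] is constant and may be read off at the junk point used by
     [cmean]. *)
  under eq_integral do rewrite (gloc _ (fun=> 0))//.
  rewrite integral_cst/=; last exact: measurable_sign_event.
  by rewrite probability_sign_event// -EFinM mulrC.
have NnJ : N \notin J by apply/negP => /NJ; rewrite ltnn.
pose B := sign_event J s; pose A c := X N @^-1` [set c].
have mB : measurable B by exact: measurable_sign_event.
have mA c : measurable (A c) by exact: measurable_sign.
have mg : measurable_fun [set: T] (EFin \o (fun w => g (fun i => X i w))).
  by apply/measurable_EFinP; apply: gmeas => i; exact: measurable_funP.
rewrite (ge0_negligible_integral (measurableC (measurableU _ _ (mA 1) (mA (-1)))))//;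
  [|exact: measurable_funTS|by move=> w _; rewrite lee_fin|exact: probability_not_sign].
rewrite setDE setCK setIUr.
have split_c c : c = 1 \/ c = -1 ->
    (\int[P]_(w in B `&` A c) (g (fun i => X i w))%:E =
     (2^-1 ^+ #|` J|.+1 * cmean N (fun x => g (upd x N c)))%:E)%E.
  move=> hc.
  have -> : #|` J|.+1 = #|` (N |` J)%fset| by rewrite cardfsU1 NnJ.
  rewrite -(IH _ _ (upd s N c))//.
  - rewrite sign_eventU1//; apply: eq_integral => w; rewrite inE => -[_ /= XNw].
    by congr (g _)%:E; apply/funext => i; rewrite /upd; case: eqP => // ->.
  - move=> j; rewrite in_fset1U => /orP[/eqP ->//|/NJ]; exact: ltnW.
  - move=> j; rewrite in_fset1U /upd; case: eqP => [//|_ /=]; exact: hs.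
  - move=> x y xy; apply: gloc => i; rewrite ltnS leq_eqVlt /upd.
    by case: eqP => //= _; exact: xy.
  - move=> Y mY.
    (* Fixing coordinate [N] amounts to replacing [Y N] by a constant; for this reason measurability
       is demanded along every measurable family and not just along [X]. *)
    have mZ i : measurable_fun [set: T] (if i == N then (fun=> c) else Y i).
      by case: ifP.
    rewrite (_ : (fun w => _) = (fun w => g (fun i =>
        (if i == N then (fun=> c) else Y i) w))); first exact: gmeas mZ.
    by apply/funext => w; congr g; apply/funext => i; rewrite /upd; case: ifP.
rewrite ge0_integral_setU; [|exact: measurableI|exact: measurableI| | |]; first last.
- apply/disj_setPS => w [[_ /= h1] [_ /= h2]].
  by have : X N w = -1 := h2; rewrite (h1 : X N w = 1); lra.
- by move=> w _; rewrite lee_fin.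
- exact: measurable_funTS.
rewrite !split_c; [|by right|by left].
by rewrite -EFinD exprSr /=; congr EFin; field.
Qed.

Lemma expectation_cmean N (g : (nat -> R) -> R) : (forall x, 0 <= g x) ->
  (forall x y, (forall i, (i < N)%N -> x i = y i) -> g x = g y) ->
  (forall Y : nat -> T -> R, (forall i, measurable_fun setT (Y i)) ->
    measurable_fun setT (fun w => g (Y^~ w))) ->
  ('E_P[fun w => g (fun i => X i w)] = (cmean N g)%:E)%E.
Proof.
move=> g0 gloc gmeas.
have := @integral_sign_event N g fset0 (fun=> 0) _ _ g0 gloc gmeas.
rewrite cardfs0 mul1r unlock => <- //.
by congr (integral _ _ _); apply/seteqP; split.
Qed.

Lemma measurable_quad f N (Y : nat -> T -> R) :
  (forall i, measurable_fun setT (Y i)) ->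
  measurable_fun setT (fun w => quad f N (Y^~ w)).
Proof.
move=> mY; apply: measurable_funM => //; apply: measurable_sum => j.
apply: measurable_sum => i; apply: measurable_funM => //.
exact: measurable_funM.
Qed.

(** An even power makes the integrand nonnegative, as [expectation_cmean] requires. *)
Lemma expectation_J2_partial f N k : ~~ odd k ->
  ('E_P[fun w => (J2_partial X f N w ^+ k)%R] =
   (cmean N (fun x => quad f N x ^+ k))%:E)%E.
Proof.
move=> k_even.
rewrite -(expectation_cmean (N := N) (g := fun x => quad f N x ^+ k))//.
- by move=> x; exact: exprn_even_ge0.
- move=> x y xy; congr (_ ^+ _); congr (_ * _).
  apply: eq_big_nat => j /andP[_ jN]; apply: eq_big_nat => i /andP[_ ij].
  by rewrite !xy// (ltn_trans ij).
- by move=> Y mY; apply: measurable_funX; exact: measurable_quad.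
Qed.

Lemma measurable_J2_partial f N : measurable_fun setT (J2_partial X f N).
Proof. by apply: (@measurable_quad f N X) => i; exact: measurable_funP. Qed.

End rademacher_expectation.

(** * Truncation of the fourth power *)

Section truncation.
Context (R : realType).
Implicit Types (x y m e : R).

Definition trunc4 m x : R := Num.min `|x| m ^+ 4.

Lemma trunc4_ge0 m x : 0 <= trunc4 m x.
Proof. exact: exprn_even_ge0. Qed.

Lemma trunc4_le m x : 0 <= m -> trunc4 m x <= x ^+ 4.
Proof.
move=> m0; rewrite -[leRHS]ger0_norm ?exprn_even_ge0// normrX /trunc4.
by rewrite lerXn2r ?nnegrE ?le_min ?normr_ge0 ?m0// ge_min lexx.
Qed.

Lemma trunc4_bound m x : 0 <= m -> trunc4 m x <= m ^+ 4.
Proof.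
move=> m0.
by rewrite /trunc4 lerXn2r ?nnegrE ?le_min ?normr_ge0 ?m0// ge_min lexx orbT.
Qed.

Lemma trunc4_id m x : `|x| <= m -> trunc4 m x = x ^+ 4.
Proof.
by move=> xm; rewrite /trunc4 min_l// -normrX ger0_norm// exprn_even_ge0.
Qed.

Lemma continuous_trunc4 m : continuous (trunc4 m).
Proof.
move=> x; apply: (@continuous_comp _ _ _ (fun y => Num.min `|y| m) (fun y => y ^+ 4)).
  apply: continuous_min; last exact: cst_continuous.
  exact: norm_continuous.
exact: exprn_continuous.
Qed.

(** Beyond [m] the factor [m ^- 2 * x ^+ 2] is at least 1. *)
Lemma le_trunc4_tail m x : 0 < m -> x ^+ 4 <= trunc4 m x + m ^- 2 * x ^+ 6.
Proof.
move=> m0; have [xm|mx] := leP `|x| m.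
  rewrite trunc4_id// lerDl mulr_ge0 ?exprn_even_ge0//.
  by rewrite invr_ge0 exprn_ge0// ltW.
apply: (@le_trans _ _ (m ^- 2 * x ^+ 6)); last by rewrite lerDr trunc4_ge0.
rewrite (_ : x ^+ 6 = x ^+ 2 * x ^+ 4); last by ring.
rewrite mulrA ler_peMl ?exprn_even_ge0//.
rewrite mulrC ler_pdivlMr ?exprn_gt0// mul1r -(real_normK (num_real x)).
by rewrite lerXn2r ?nnegrE ?ltW// (lt_trans m0).
Qed.

(** The fourth power has derivative at most [4 * m ^+ 3] on [[0, m]], and clipping does not increase
    distances. *)
Lemma trunc4_lip m x y : 0 <= m ->
  `|trunc4 m x - trunc4 m y| <= 4 * m ^+ 3 * `|x - y|.
Proof.
move=> m0; rewrite /trunc4.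
have am (z : R) : 0 <= Num.min `|z| m <= m.
  by rewrite le_min normr_ge0 m0/= ge_min lexx orbT.
have dxy : `|Num.min `|x| m - Num.min `|y| m| <= `|x - y|.
  apply: (@le_trans _ _ `|(`|x|) - (`|y|)|); last exact: ler_dist_dist.
  have := ler_norm (`|x| - `|y|); have := ler_norm (- (`|x| - `|y|)); rewrite normrN.
  have := normr_ge0 (`|x| - `|y|).
  by rewrite ler_norml; rewrite /Num.min; do 2 case: ifPn; rewrite -?leNgt; lra.
move: (am x) (am y) dxy.
move: (Num.min `|x| m) (Num.min `|y| m) => a b /andP[a0 am1] /andP[b0 bm1] dab.
rewrite (_ : a ^+ 4 - b ^+ 4 = (a ^+ 3 + a ^+ 2 * b + a * b ^+ 2 + b ^+ 3) * (a - b));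
  last by ring.
rewrite normrM ler_pM//.
rewrite ger0_norm; last by rewrite !addr_ge0 ?mulr_ge0 ?exprn_ge0.
have a2 : a ^+ 2 <= m ^+ 2 by rewrite lerXn2r.
have b2 : b ^+ 2 <= m ^+ 2 by rewrite lerXn2r.
have a3 : a ^+ 3 <= m ^+ 3 by rewrite lerXn2r.
have b3 : b ^+ 3 <= m ^+ 3 by rewrite lerXn2r.
have ab1 : a ^+ 2 * b <= m ^+ 2 * m by rewrite ler_pM// exprn_ge0.
have ab2 : a * b ^+ 2 <= m * m ^+ 2 by rewrite ler_pM// exprn_ge0.
by move: ab1 ab2; rewrite -exprS -exprSr; lra.
Qed.

(** Young's inequality trades the distance in the Lipschitz bound for its square, whose expectation
    is what [is_J2] controls. *)
Lemma trunc4_le_add m e x y : 0 <= m -> 0 < e ->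
  trunc4 m x <= trunc4 m y + e + 4 * m ^+ 6 / e * (x - y) ^+ 2.
Proof.
move=> m0 e0; have := trunc4_lip x y m0; have := ler_norm (trunc4 m x - trunc4 m y).
move=> h1 h2; have {h1 h2} := le_trans h1 h2.
rewrite -[(x - y) ^+ 2]real_normK ?num_real//; move: `|x - y| => t.
rewrite -addrA -lerBlDl => h; apply: le_trans h _; rewrite -subr_ge0.
rewrite (_ : _ - _ = (e - 2 * m ^+ 3 * t) ^+ 2 / e); last by field; rewrite gt_eqF.
by rewrite divr_ge0 ?sqr_ge0// ltW.
Qed.

(** Young's inequality for the cross term of [(y + (x - y)) ^+ 2]; it carries second moments between
    [F] and its truncations. *)
Lemma sqr_le_add e x y : 0 < e ->
  x ^+ 2 <= (1 + e) * y ^+ 2 + (1 + e^-1) * (x - y) ^+ 2.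
Proof.
move=> e0; rewrite -subr_ge0 (_ : _ - _ = (e * y - (x - y)) ^+ 2 / e).
  by rewrite divr_ge0 ?sqr_ge0// ltW.
by field; rewrite gt_eqF.
Qed.

End truncation.

Section expectation_bounds.
Context (d : measure_display) (T : measurableType d) (R : realType).
Variable P : probability T R.

(** Working with nonnegative integrals avoids settling integrability first. Three functions are
    provided for because the upper estimate of the fourth moment involves [trunc4] of [F], the L2
    error and a sixth moment. *)
Lemma ge0_expectation_le (u v w z : T -> R) (a b c e : R) :
  measurable_fun setT u -> measurable_fun setT v ->
  measurable_fun setT w -> measurable_fun setT z ->
  (forall t, 0 <= u t) -> (forall t, 0 <= v t) ->
  (forall t, 0 <= w t) -> (forall t, 0 <= z t) ->
  0 <= a -> 0 <= b -> 0 <= c -> 0 <= e ->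
  (forall t, u t <= e + a * v t + b * w t + c * z t) ->
  ('E_P[u] <= e%:E + a%:E * 'E_P[v] + b%:E * 'E_P[w] + c%:E * 'E_P[z])%E.
Proof.
move=> mu mv mw mz u0 v0 w0 z0 a0 b0 c0 e0 le_u.
rewrite -(expectation_cst P e) unlock.
have mE (g : T -> R) : measurable_fun setT g -> measurable_fun setT (EFin \o g).
  by move=> mg; exact/measurable_EFinP.
have mZ (k : R) (g : T -> R) : measurable_fun setT g ->
    measurable_fun setT (fun t => k%:E * (g t)%:E)%E.
  by move=> mg; apply: measurable_funeM; exact: mE.
have ge0Z (k : R) (g : T -> R) t : 0 <= k -> (forall t, 0 <= g t) ->
    (0 <= k%:E * (g t)%:E)%E.
  by move=> k0 g0; rewrite -EFinM lee_fin mulr_ge0.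
have ge0I (k : R) (g : T -> R) : 0 <= k -> (forall t, 0 <= g t) ->
    measurable_fun setT g ->
    (\int[P]_t (k%:E * (g t)%:E) = k%:E * \int[P]_t (g t)%:E)%E.
  move=> k0 g0 mg; apply: ge0_integralZl => //; first exact: mE.
  by move=> t _; rewrite lee_fin.
have m1 : measurable_fun [set: T] (EFin \o cst e) by exact: mE.
have m2 := emeasurable_funD m1 (mZ a v mv).
have m3 := emeasurable_funD m2 (mZ b w mw).
have m4 := emeasurable_funD m3 (mZ c z mz).
rewrite -!ge0I// -!ge0_integralD//; try by move=> t _; rewrite ?adde_ge0 ?ge0Z ?lee_fin.
all: try by [exact: mZ | exact: m1 | exact: m2 | exact: m3].
apply: ge0_le_integral => //.
- by move=> t _; rewrite lee_fin.
- exact: mE.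
- by move=> t _; rewrite -!EFinM -!EFinD lee_fin.
Qed.

End expectation_bounds.

(** * Fourth moment of the standard normal law *)

Section normal_moment.
Context (R : realType).
Notation mu := lebesgue_measure.
Notation phi := (normal_pdf (0 : R) 1).

Lemma integral_normal_prob (f : R -> R) : measurable_fun setT f ->
  (normal_prob (0 : R) 1).-integrable setT (EFin \o f) ->
  (\int[normal_prob (0 : R) 1]_x (f x)%:E = \int[mu]_x (f x * phi x)%:E)%E.
Proof.
move=> mf intf.
have mphi := measurable_normal_pdf (0 : R) 1.
have dom := normal_prob_dominates (0 : R) 1.
rewrite -(Radon_Nikodym_change_of_variables dom)//=.
under [RHS]eq_integral do rewrite EFinM.
apply: ae_eq_integral => //.
- apply: emeasurable_funM; first exact/measurable_EFinP.
  by apply: (measurable_int mu); exact: Radon_Nikodym_integrable.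
- by apply: emeasurable_funM; exact/measurable_EFinP.
- apply: ae_eqe_mul2l => /=.
  rewrite Radon_NikodymE//=; case: cid => /= h [h1 h2 h3].
  apply: integral_ae_eq => //=.
  + exact/measurable_EFinP.
  + by move=> E E01 mE; rewrite -h3.
Qed.

Lemma normal_pdf01E x : phi x = normal_peak (1 : R) * expR (- (x ^+ 2 / 2)).
Proof.
rewrite normal_pdfE ?oner_neq0// /normal_fun subr0 expr1n mulNr.
by rewrite -mulr_natr mul1r.
Qed.

Lemma is_derive_normal_pdf (x : R) : is_derive x (1 : R) phi (- x * phi x).
Proof.
pose g : R -> R := - ((@idfun R) ^+ 2 * cst (2^-1)).
have phiE : phi = cst (normal_peak (1 : R)) * (expR \o g).
  by apply/funext => y; rewrite normal_pdf01E.
have dg : is_derive x (1 : R) g (- x).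
  apply: is_derive_eq; rewrite /GRing.scale/= !mulr1; by field.
have de := is_derive1_comp (is_derive_expR _) dg.
rewrite phiE; apply: is_derive_eq.
by rewrite /GRing.scale/= mulr0 addr0 !fctE/=; ring.
Qed.

(** An elementary antiderivative of [(x ^+ 4 - 3) * phi x], which reduces the fourth moment to the
    total mass of [phi]. *)
Definition normal_prim (x : R) := - ((x ^+ 3 + 3 * x) * phi x).

Lemma is_derive_normal_prim (x : R) :
  is_derive x (1 : R) normal_prim ((x ^+ 4 - 3) * phi x).
Proof.
have h := is_derive_normal_pdf x.
have h2 : is_derive x (1 : R) (- (((@idfun R) ^+ 3 + cst 3 * (@idfun R)) * phi))
  ((x ^+ 4 - 3) * phi x).
  by apply: is_derive_eq; rewrite /GRing.scale/= !fctE/=; ring.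
exact: h2.
Qed.

Lemma continuous_pow4_normal_pdf : continuous (fun x : R => x ^+ 4 * phi x).
Proof.
move=> x; apply: cvgM; first exact: exprn_continuous.
by apply: continuous_normal_pdf; rewrite oner_eq0.
Qed.

Lemma integral_pow4_segment (a : R) : 0 < a ->
  (\int[mu]_(x in `[(- a)%R, a]) (x ^+ 4 * phi x)%:E =
   3%:E * \int[mu]_(x in `[(- a)%R, a]) (phi x)%:E
   + (2 * normal_prim a)%:E)%E.
Proof.
move=> a0.
have cphi : continuous phi by apply: continuous_normal_pdf; rewrite oner_eq0.
have cprim : continuous normal_prim.
  move=> x; apply: differentiable_continuous; apply/derivable1_diffP.
  by have [] := is_derive_normal_prim x.
have iphi : mu.-integrable `[- a, a] (EFin \o phi).
  by apply: continuous_compact_integrable;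
    [exact: segment_compact|exact: continuous_subspaceT].
have c4 := continuous_pow4_normal_pdf.
have cf : continuous (fun x : R => (x ^+ 4 - 3) * phi x).
  move=> x; apply: cvgM; last exact: cphi.
  by apply: cvgB; [exact: exprn_continuous|exact: cvg_cst].
have if3 : mu.-integrable `[- a, a] (EFin \o (fun x : R => (x ^+ 4 - 3) * phi x)).
  by apply: continuous_compact_integrable;
    [exact: segment_compact|exact: continuous_subspaceT].
have FTC : (\int[mu]_(x in `[(- a)%R, a]) ((x ^+ 4 - 3) * phi x)%:E =
    (normal_prim a)%:E - (normal_prim (- a))%:E)%E.
  apply: continuous_FTC2.
  - lra.
  - exact: continuous_subspaceT.
  - split.
    + by move=> x _; have [] := is_derive_normal_prim x.
    + by apply: cvg_at_right_filter; exact: cprim.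
    + by apply: cvg_at_left_filter; exact: cprim.
  - by move=> x _; rewrite derive1E; have [_ ->] := is_derive_normal_prim x.
have prN : normal_prim (- a) = - normal_prim a.
  by rewrite /normal_prim !normal_pdf01E sqrrN; ring.
under eq_integral => x _.
  rewrite (_ : x ^+ 4 * phi x = (x ^+ 4 - 3) * phi x + 3 * phi x); last by ring.
  rewrite EFinD (EFinM 3); over.
rewrite integralD//; last first.
  exact: integrableZl.
rewrite FTC integralZl// addeC; congr (_ + _)%E.
by rewrite prN -EFinB; congr EFin; ring.
Qed.

Lemma normal_prim_cvg0 : normal_prim n%:R @[n --> \oo] --> (0 : R).
Proof.
pose k := normal_peak (1 : R).
have k0 : 0 <= k by exact: normal_peak_ge0.
apply/cvgrPdist_le => e e0; near=> n.
have n1 : 1 <= n%:R :> R by near: n; exact: nbhs_infty_ger.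
(* The exponential is at most [8 / x ^+ 4], by the quadratic term of its series, and
   [x ^+ 3 + 3 * x <= 4 * x ^+ 3]; so the absolute value is at most [32 * k / x]. *)
have nC : 32 * k / e <= n%:R by near: n; exact: nbhs_infty_ger.
have n0 : 0 < n%:R :> R by exact: lt_le_trans n1.
rewrite sub0r normrN /normal_prim normrN normal_pdf01E -/k.
move: (n%:R : R) n1 nC n0 => x x1 xC x0.
have x20 : 0 <= x ^+ 2 by exact: sqr_ge0.
have hexp : expR (- (x ^+ 2 / 2)) <= 8 / x ^+ 4.
  rewrite expRN -[leRHS]invrK lef_pV2 ?posrE ?expR_gt0 ?invr_gt0 ?divr_gt0 ?exprn_gt0//.
  rewrite invf_div.
  have := @expR_ge1Dxn R (x ^+ 2 / 2) 1 (divr_ge0 x20 (ler0n _ _)).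
  rewrite (_ : (x ^+ 2 / 2) ^+ 2 / 2`!%:R = x ^+ 4 / 8); first by lra.
  by rewrite (_ : 2`! = 2%N)//; field.
rewrite ger0_norm; last first.
  by rewrite !mulr_ge0 ?expR_ge0// addr_ge0// ?exprn_ge0 ?mulr_ge0 ?ltW.
apply: (@le_trans _ _ ((4 * x ^+ 3) * (k * (8 / x ^+ 4)))).
  rewrite ler_pM//.
  - by rewrite addr_ge0// ?exprn_ge0 ?mulr_ge0 ?ltW.
  - by rewrite mulr_ge0 ?expR_ge0.
  - have : x <= x ^+ 3 by rewrite -[leLHS]mulr1 exprS ler_wpM2l ?exprn_ege1// ltW.
    lra.
  - exact: ler_wpM2l.
rewrite [leLHS](_ : _ = 32 * k / x); last by field; rewrite gt_eqF.
by rewrite ler_pdivrMr// (mulrC e) -ler_pdivrMr.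
Unshelve. all: by end_near. Qed.

Let pow4_ge0 (x : R) : (0 <= (x ^+ 4 * phi x)%:E)%E.
Proof. by rewrite lee_fin mulr_ge0 ?exprn_even_ge0 ?normal_pdf_ge0. Qed.

Let measurable_pow4 : measurable_fun setT (EFin \o (fun x : R => x ^+ 4 * phi x)).
Proof.
apply/measurable_EFinP; apply: measurable_funM; last exact: measurable_normal_pdf.
exact: measurable_funX.
Qed.

Lemma cvg_integral_segment (f : R -> R) : measurable_fun setT f ->
  (forall x, 0 <= f x) ->
  (\int[mu]_(x in `[(- n%:R)%R, n%:R]) (f x)%:E @[n --> \oo]
   --> \int[mu]_x (f x)%:E)%E.
Proof.
move=> mf f0.
have -> : [set: R] = \bigcup_n `[(- n%:R)%R, n%:R]%classic by rewrite (bigcup_itvT true false).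
apply: ge0_nondecreasing_set_cvg_integral => //.
- move=> m n mn; apply/subsetPset => x /=; rewrite !in_itv/= => /andP[h1 h2].
  have mnR : m%:R <= n%:R :> R by rewrite ler_nat.
  by apply/andP; split; lra.
- by move=> n; apply/measurable_EFinP; exact: measurable_funTS.
- by move=> n x _; rewrite lee_fin.
Qed.

Lemma integral_pow4_normal : (\int[mu]_x (x ^+ 4 * phi x)%:E = 3%:E)%E.
Proof.
have h4 : (\int[mu]_(x in `[(- n%:R)%R, n%:R]) (x ^+ 4 * phi x)%:E @[n --> \oo]
    --> \int[mu]_x (x ^+ 4 * phi x)%:E)%E.
  by apply: cvg_integral_segment => [|x]; [exact/measurable_EFinP|rewrite -lee_fin].
have h0 : (\int[mu]_(x in `[(- n%:R)%R, n%:R]) (phi x)%:E @[n --> \oo]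
    --> \int[mu]_x (phi x)%:E)%E.
  by apply: cvg_integral_segment => [|x]; [exact: measurable_normal_pdf|exact: normal_pdf_ge0].
rewrite integral_normal_pdf in h0.
apply: (cvg_unique _ h4) => //.
have : ((3%:E * \int[mu]_(x in `[(- n%:R)%R, n%:R]) (phi x)%:E
    + (2 * normal_prim n%:R)%:E) @[n --> \oo] --> 3%:E * 1 + (2 * 0)%:E)%E.
  apply: cvgeD => //; first exact: cvgeZl.
  by apply: cvg_EFin; [exact: nearW|apply: cvgMr; exact: normal_prim_cvg0].
rewrite mule1 mulr0 adde0; apply: cvg_trans; apply: near_eq_cvg; near=> n.
by rewrite integral_pow4_segment// ltr0n; near: n; exact: nbhs_infty_gt.
Unshelve. all: by end_near. Qed.

(** Monotone convergence: at each [x] the truncation is exact as soon as [n] exceeds the absolute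
    value of [x]. *)
Lemma cvg_normal_trunc4 :
  (\int[normal_prob (0 : R) 1]_x (trunc4 n%:R x)%:E @[n --> \oo] --> 3%:E)%E.
Proof.
have mt n : measurable_fun setT (trunc4 n%:R : R -> R).
  by apply: continuous_measurable_fun; exact: continuous_trunc4.
have mtphi n : measurable_fun setT (fun x : R => trunc4 n%:R x * phi x).
  by apply: measurable_funM => //; exact: measurable_normal_pdf.
have -> : (fun n => \int[normal_prob (0 : R) 1]_x (trunc4 n%:R x)%:E)%E =
    (fun n => \int[mu]_x (trunc4 n%:R x * phi x)%:E)%E.
  apply/funext => n; rewrite integral_normal_prob//.
  apply/integrableP; split; first by apply/measurable_EFinP; exact: mt.
  apply: (@le_lt_trans _ _ (\int[normal_prob (0 : R) 1]_x (n%:R ^+ 4)%:E)%E).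
    apply: ge0_le_integral => //.
    - by apply: measurableT_comp => //; apply/measurable_EFinP; exact: mt.
    - move=> x _ /=; rewrite lee_fin ger0_norm ?trunc4_ge0//.
      exact: trunc4_bound.
  by rewrite integral_cst// [X in (_ * X)%E]probability_setT mule1 ltry.
rewrite -integral_pow4_normal.
have -> : (\int[mu]_x (x ^+ 4 * phi x)%:E =
    \int[mu]_x limn (fun n => (trunc4 n%:R x * phi x)%:E))%E.
  apply: eq_integral => x _; apply/esym/cvg_lim => //.
  apply: cvg_near_cst; near=> n.
  by rewrite trunc4_id//; near: n; exact: nbhs_infty_ger.
apply: cvg_monotone_convergence => //.
- by move=> n; apply/measurable_EFinP; exact: mtphi.
- by move=> n x _; rewrite lee_fin mulr_ge0 ?trunc4_ge0 ?normal_pdf_ge0.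
- move=> x _ m n mn; rewrite lee_fin ler_wpM2r ?normal_pdf_ge0// /trunc4.
  rewrite lerXn2r ?nnegrE ?le_min ?normr_ge0//= ge_min lexx/= ge_min ler_nat mn.
  by rewrite orbT.
Unshelve. all: by end_near. Qed.

End normal_moment.

(** * The fourth cumulant *)

Section fourth_cumulant.
Context (R : realType).
Implicit Types f : nat * nat -> R.

Lemma sqsum_gram_diag f N :
  sqsum N (fun p => (gram f N p * \1_(~` Delta2) p) ^+ 2) =
  \sum_(0 <= i < N) gram f N (i, i) ^+ 2.
Proof.
rewrite /sqsum !big_mkord; apply: eq_bigr => i _.
rewrite big_mkord (bigD1 i)//= big1 => [|j ji].
  by rewrite indicE mem_set ?mulr1 ?addr0//= /Delta2/=; apply.
rewrite indicE memNset ?mulr0 ?expr0n//= /Delta2/= => h; apply: h => ij.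
by move/eqP: ji; apply; apply/val_inj.
Qed.

Lemma sqsum_gram_split f N :
  sqsum N (fun p => gram f N p ^+ 2) =
  sqsum N (fun p => (gram f N p * \1_Delta2 p) ^+ 2)
  + sqsum N (fun p => (gram f N p * \1_(~` Delta2) p) ^+ 2).
Proof.
rewrite -sqsumD; apply: eq_bigr => i _; apply: eq_bigr => j _.
rewrite !indicE in_setC; case: (_ \in _) => /=; ring.
Qed.

(** The norms are extended reals; their finiteness is settled here along with the limit, so that
    what follows is real arithmetic on [q]. *)
Lemma cmean_quad4_cvg f (s : R) : l20_sym f ->
  2 * sqsum N (fun p => f p ^+ 2) @[N --> \oo] --> s ->
  exists2 q : R,
    (2%:E * lpnorm 4 f ^+ 4
     + 3%:E * (lpnorm 2 (star11 f \* \1_Delta2)%R ^+ 2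
               - lpnorm 2 (star11 f \* \1_(~` Delta2))%R ^+ 2) = q%:E)%E &
    cmean N (fun x => quad f N x ^+ 4) @[N --> \oo] --> 3 * s ^+ 2 + 16 * q.
Proof.
move=> [fsym fsum fdiag] fs.
have [B fB] := summable_sqsum_bound fsum.
have [l4 -> cl4] := is_cvg_sqsum4 fB.
have [l1 -> cl1] := cvg_sqsum_gram fB Delta2.
have [l2 -> cl2] := cvg_sqsum_gram fB (~` Delta2).
exists (2 * l4 + 3 * (l1 - l2)); first by [].
under eq_fun do rewrite cmean_quad4// sqsum_gram_split -sqsum_gram_diag.
rewrite (_ : (fun N => _) = (fun N =>
  3 * ((2 * sqsum N (fun p => f p ^+ 2)) * (2 * sqsum N (fun p => f p ^+ 2)))
  + 16 * (2 * sqsum N (fun p => f p ^+ 4)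
          + 3 * (sqsum N (fun p => (gram f N p * \1_Delta2 p) ^+ 2)
                 - sqsum N (fun p => (gram f N p * \1_(~` Delta2) p) ^+ 2)))));
  last by apply/funext => N; ring.
rewrite expr2.
apply: cvgD; apply: cvgMr; first exact: cvgM.
by apply: cvgD; apply: cvgMr => //; exact: cvgB.
Qed.

End fourth_cumulant.

(** * Comparison of the chaos with its truncations *)

Section chaos.
Context (d : measure_display) (T : measurableType d) (R : realType).
Variables (P : probability T R) (X : nat -> {RV P >-> R}).
Hypothesis hX : rademacher_sequence X.
Variables (f : nat * nat -> R) (F : {RV P >-> R}).
Hypothesis hf : l20_sym f.
Hypothesis hF : is_J2 X f F.
Hypothesis hvar : 'E_P[(fun w => F w ^+ 2)%R]%E = 1%E.

Let G N := J2_partial X f N.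

Let mF : measurable_fun setT F.
Proof. exact: measurable_funP. Qed.

Let mG N : measurable_fun setT (G N).
Proof. exact: measurable_J2_partial. Qed.

Let mFG N : measurable_fun setT (fun w => (F w - G N w) ^+ 2).
Proof. by apply: measurable_funX; exact: measurable_funB. Qed.

Let err N := fine 'E_P[(fun w => (F w - G N w) ^+ 2)%R]%E.

Let err_cvg0 : err N @[N --> \oo] --> (0 : R).
Proof. by have /fine_cvgP[] := hF. Qed.

Let errE : \forall N \near \oo,
  ('E_P[(fun w => (F w - G N w) ^+ 2)%R] = (err N)%:E)%E.
Proof.
have /fine_cvgP[hfin _] := hF.
by near=> N; rewrite /err fineK//; near: N.
Unshelve. all: by end_near. Qed.

(** The limit exists by monotonicity. Each inequality comes from [sqr_le_add], with the roles of [F]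
    and [G N] exchanged: [N] grows first, then [e] shrinks. *)
Let var_cvg : 2 * sqsum N (fun p => f p ^+ 2) @[N --> \oo] --> (1 : R).
Proof.
have [fsym fsum fdiag] := hf.
have [B fB] := summable_sqsum_bound fsum.
pose a N := 2 * sqsum N (fun p => f p ^+ 2).
have ca : cvgn a.
  apply: is_cvgMr; apply: is_cvg_sqsum fB => p; exact: sqr_ge0.
have EG N : ('E_P[(fun w => G N w ^+ 2)%R] = (a N)%:E)%E.
  by rewrite /G expectation_J2_partial// cmean_quad2.
have cerr c b : c * a N + b * err N @[N --> \oo] --> c * limn a + b * 0.
  by apply: cvgD; apply: cvgMr.
have cerr1 (c b : R) : c + b * err N @[N --> \oo] --> c + b * 0.
  by apply: cvgD; [exact: cvg_cst|apply: cvgMr].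
have m2 (H : T -> R) : measurable_fun setT H -> measurable_fun setT (fun w => H w ^+ 2).
  by move=> mH; exact: measurable_funX.
have a1 : limn a <= 1.
  apply/ler_addgt0Pr => e e0; rewrite -[leRHS]addr0 -(mulr0 (1 + e^-1)).
  apply: (ler_cvg_to ca (cerr1 (1 + e) (1 + e^-1))); near=> N.
  have e1 : 0 <= 1 + e by rewrite addr_ge0 ?ltW.
  have e2 : 0 <= 1 + e^-1 by rewrite addr_ge0 ?invr_ge0 ?ltW.
  have := @ge0_expectation_le _ _ _ P (fun w => G N w ^+ 2) (fun w => F w ^+ 2)
    (fun w => (F w - G N w) ^+ 2) (fun=> 0) (1 + e) (1 + e^-1) 0 0
    (m2 _ (mG N)) (m2 _ mF) (mFG N) (measurable_cst _)
    (fun=> sqr_ge0 _) (fun=> sqr_ge0 _) (fun=> sqr_ge0 _) (fun=> lexx _)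
    e1 e2 (lexx 0) (lexx 0).
  rewrite hvar EG (near errE N)// mule1 mul0e adde0 add0e -EFinM -EFinD lee_fin.
  apply => w; rewrite add0r mulr0 addr0 -(sqrrN (F w - _)) opprB.
  exact: sqr_le_add.
have a2 : 1 <= limn a.
  apply/ler_addgt0Pr => e e0.
  apply: (@le_trans _ _ ((1 + e) * limn a)); last first.
    by rewrite mulrDl mul1r lerD2l ler_piMr// ltW.
  rewrite -[leRHS]addr0 -(mulr0 (1 + e^-1)).
  apply: (ler_cvg_to (cvg_cst _) (cerr (1 + e) (1 + e^-1))); near=> N.
  have e1 : 0 <= 1 + e by rewrite addr_ge0 ?ltW.
  have e2 : 0 <= 1 + e^-1 by rewrite addr_ge0 ?invr_ge0 ?ltW.
  have := @ge0_expectation_le _ _ _ P (fun w => F w ^+ 2) (fun w => G N w ^+ 2)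
    (fun w => (F w - G N w) ^+ 2) (fun=> 0) (1 + e) (1 + e^-1) 0 0
    (m2 _ mF) (m2 _ (mG N)) (mFG N) (measurable_cst _)
    (fun=> sqr_ge0 _) (fun=> sqr_ge0 _) (fun=> sqr_ge0 _) (fun=> lexx _)
    e1 e2 (lexx 0) (lexx 0).
  rewrite hvar EG (near errE N)// mul0e adde0 add0e -!EFinM -EFinD lee_fin.
  by apply => w; rewrite add0r mulr0 addr0; exact: sqr_le_add.
have aE : limn a = 1 by apply/eqP; rewrite eq_le a1 a2.
by rewrite -[X in _ --> X]aE; exact: ca.
Unshelve. all: by end_near. Qed.

Let var_le1 N : 2 * sqsum N (fun p => f p ^+ 2) <= 1.
Proof.
pose a N := 2 * sqsum N (fun p => f p ^+ 2).
have lim1 : limn a = 1 by exact/cvg_lim.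
have nd : nondecreasing_seq a.
  move=> m n mn; rewrite ler_pM2l//.
  by apply: nondecreasing_sqsum mn => p; exact: sqr_ge0.
by rewrite -[leRHS]lim1; apply: nondecreasing_cvgn_le nd _ _; apply/cvg_ex; exists 1.
Qed.

(** The variance is at most 1, so the strict bound in [cmean_quad6] holds with [s = 2]; the result
    depends on neither [N] nor [f]. *)
Let sixth_le N : cmean N (fun x => quad f N x ^+ 6) <= (15 * 250) * 2 ^+ 3.
Proof.
have [fsym fsum fdiag] := hf.
apply: cmean_quad6 => //.
by apply: le_lt_trans (var_le1 N) _; rewrite ltr1n.
Qed.

(** The term [e] pays for exchanging [G N] and [F] inside [trunc4], the term in [m] for the
    truncation itself. Neither depends on [f], so the bound is uniform along a sequence of
    kernels. *)
Lemma fourth_cumulant_trunc : exists2 q : R,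
  (2%:E * lpnorm 4 f ^+ 4
   + 3%:E * (lpnorm 2 (star11 f \* \1_Delta2)%R ^+ 2
             - lpnorm 2 (star11 f \* \1_(~` Delta2))%R ^+ 2) = q%:E)%E &
  forall (m e : R), 0 < m -> 0 < e ->
    `|3 + 16 * q - fine 'E_P[trunc4 m \o F]%E| <= e + 15 * 250 * 2 ^+ 3 * m ^- 2.
Proof.
have [q -> cq] := cmean_quad4_cvg hf var_cvg; exists q => // m e m0 e0.
rewrite expr1n mulr1 in cq.
pose h := trunc4 m; pose C := 4 * m ^+ 6 / e; pose K : R := 15 * 250 * 2 ^+ 3.
have C0 : 0 <= C by rewrite divr_ge0 ?mulr_ge0 ?exprn_ge0 ?ltW.
have mm0 : 0 <= m ^- 2 by rewrite invr_ge0 exprn_ge0// ltW.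
have mh : measurable_fun [set: T] (h \o F).
  apply: measurableT_comp => //.
  by apply: continuous_measurable_fun; exact: continuous_trunc4.
have h0 w : 0 <= (h \o F) w by exact: trunc4_ge0.
pose H := fine 'E_P[h \o F]%E.
have HE : ('E_P[h \o F] = H%:E)%E.
  rewrite /H fineK// ge0_fin_numE; last exact: expectation_ge0.
  apply: (@le_lt_trans _ _ (m ^+ 4)%:E); last exact: ltry.
  rewrite -(expectation_cst P (m ^+ 4)).
  apply: expectation_le => //.
  - by move=> w; rewrite exprn_ge0// ltW.
  - by apply: nearW => w; exact: trunc4_bound (ltW m0).
have cC (c b : R) : c + b * err N @[N --> \oo] --> c + b * 0.
  by apply: cvgD; [exact: cvg_cst|apply: cvgMr].
have mX k (Y : T -> R) : measurable_fun setT Y -> measurable_fun setT (fun w => Y w ^+ k).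
  by move=> mY; exact: measurable_funX.
have e4 (y : R) : 0 <= y ^+ 4 by exact: exprn_even_ge0.
have e6 (y : R) : 0 <= y ^+ 6 by exact: exprn_even_ge0.
have up : 3 + 16 * q <= H + e + K * m ^- 2.
  rewrite -[leRHS]addr0 -(mulr0 C).
  apply: (ler_cvg_to cq (cC _ C)); near=> N.
  have := @ge0_expectation_le _ _ _ P (fun w => G N w ^+ 4) (h \o F)
    (fun w => (F w - G N w) ^+ 2) (fun w => G N w ^+ 6) 1 C (m ^- 2) e
    (mX 4 _ (mG N)) mh (mFG N) (mX 6 _ (mG N))
    (fun=> e4 _) h0 (fun=> sqr_ge0 _) (fun=> e6 _)
    ler01 C0 mm0 (ltW e0).
  rewrite HE (near errE N)// !expectation_J2_partial// mul1e -!EFinM -!EFinD lee_fin.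
  move=> le4; have sixth := ler_wpM2l mm0 (sixth_le N).
  apply: le_trans (le4 _) _; last by rewrite -/K mulrC in sixth; lra.
  move=> w /=; apply: le_trans (le_trunc4_tail _ m0) _; rewrite lerD2r mul1r.
  have := trunc4_le_add (G N w) (F w) (ltW m0) e0.
  by rewrite -(sqrrN (G N w - _)) opprB -/h -/C; lra.
(* In this direction the truncation costs nothing, since [trunc4] lies below the fourth power. *)
have dn : H <= 3 + 16 * q + e.
  rewrite -[leRHS]addr0 -(mulr0 C).
  have cq' : (cmean N (fun x => quad f N x ^+ 4) + e) + C * err N @[N --> \oo] -->
      (3 + 16 * q + e) + C * 0.
    by apply: cvgD; [apply: cvgD => //; exact: cvg_cst|apply: cvgMr].
  apply: (ler_cvg_to (cvg_cst H) cq'); near=> N.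
  have := @ge0_expectation_le _ _ _ P (h \o F) (fun w => G N w ^+ 4)
    (fun w => (F w - G N w) ^+ 2) (fun=> 0) 1 C 0 e
    mh (mX 4 _ (mG N)) (mFG N) (measurable_cst _)
    h0 (fun=> e4 _) (fun=> sqr_ge0 _) (fun=> lexx _)
    ler01 C0 (lexx 0) (ltW e0).
  rewrite HE (near errE N)// expectation_J2_partial// mul1e mul0e adde0.
  rewrite -!EFinM -!EFinD lee_fin => le4.
  apply: le_trans (le4 _) _; last by lra.
  move=> w /=; rewrite mulr0 addr0 mul1r.
  apply: le_trans (trunc4_le_add (F w) (G N w) (ltW m0) e0) _.
  by have := trunc4_le (G N w) (ltW m0); rewrite -/C; lra.
rewrite -/h -/H -/K ler_norml; apply/andP; split; last by lra.
have : 0 <= K * m ^- 2 by rewrite mulr_ge0// /K !mulr_ge0 ?exprn_ge0.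
lra.
Unshelve. all: by end_near. Qed.

End chaos.

Theorem theorem4p3 (d : measure_display) (T : measurableType d) (R : realType)
  (P : probability T R) (X : nat -> {RV P >-> R})
  (hX : rademacher_sequence X)
  (f : nat -> nat * nat -> R) (hf : forall n, l20_sym (f n))
  (F : nat -> {RV P >-> R}) (hF : forall n, is_J2 X (f n) (F n))
  (hvar : forall n, 'E_P[(fun w => F n w ^+ 2)%R]%E = 1%E)
  (hconv : converges_in_law F (normal_prob 0 1)) :
  (2%:E * lpnorm 4 (f n) ^+ 4
   + 3%:E * (lpnorm 2 (star11 (f n) \* \1_Delta2)%R ^+ 2
             - lpnorm 2 (star11 (f n) \* \1_(~` Delta2))%R ^+ 2))%E
    @[n --> \oo] --> 0%E.
Proof.
pose S n := (2%:E * lpnorm 4 (f n) ^+ 4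
  + 3%:E * (lpnorm 2 (star11 (f n) \* \1_Delta2)%R ^+ 2
            - lpnorm 2 (star11 (f n) \* \1_(~` Delta2))%R ^+ 2))%E.
pose K : R := 15 * 250 * 2 ^+ 3.
have /choice[q hq] : forall n, exists q : R, S n = q%:E /\
    forall m e, 0 < m -> 0 < e ->
      `|3 + 16 * q - fine 'E_P[trunc4 m \o F n]%E| <= e + K * m ^- 2.
  by move=> n; have [q] := fourth_cumulant_trunc hX (hf n) (hF n) (hvar n); exists q.
change (S n @[n --> \oo] --> 0%E).
under eq_fun do rewrite (hq _).1.
apply: cvg_EFin; first exact: nearW.
apply/cvgrPdist_le => e e0.
have /fine_cvgP[Jfin cJ] := @cvg_normal_trunc4 R.
(* [m] is fixed before [n]: convergence in law is applied to a single test function, while the bound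
   in [hq] holds for all [n] at once. *)
near \oo => m.
have m1 : 1 <= m%:R :> R by near: m; exact: nbhs_infty_ger.
have mK : K / e <= m%:R by near: m; exact: nbhs_infty_ger.
have m0 : 0 < m%:R :> R by exact: lt_le_trans m1.
have Jm : (\int[normal_prob (0 : R) 1]_x (trunc4 m%:R x)%:E \is a fin_num)%E.
  by near: m.
have Jm3 : `|3 - fine (\int[normal_prob (0 : R) 1]_x (trunc4 m%:R x)%:E)%E| <= e.
  by near: m; exact: (cvgrPdist_le _ _).1 cJ _ e0.
have K0 : 0 <= K by rewrite /K !mulr_ge0 ?exprn_ge0.
have Km : K * m%:R ^- 2 <= e.
  rewrite ler_pdivrMr ?exprn_gt0//; rewrite ler_pdivrMr// in mK.
  apply: le_trans mK _; rewrite mulrC ler_pM2l// expr2.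
  by rewrite ler_peMl// ltW.
have ctr : continuous (trunc4 m%:R : R -> R) by exact: continuous_trunc4.
have btr : exists M : R, forall x, `|trunc4 m%:R x| <= M.
  exists (m%:R ^+ 4) => x; rewrite ger0_norm ?trunc4_ge0//.
  exact: trunc4_bound (ltW m0).
have := hconv _ ctr btr; rewrite -[X in _ --> X]fineK// => /fine_cvgP[_ cH].
near=> n.
have Hn : `|fine (\int[normal_prob (0 : R) 1]_x (trunc4 m%:R x)%:E)%E
    - fine 'E_P[trunc4 m%:R \o F n]%E| <= e.
  by near: n; exact: (cvgrPdist_le _ _).1 cH _ e0.
(* The distance from [16 * q n] to 0 is at most [4 * e]: twice [e] from [hq] and [Km], once from the
   convergence in law, once from the truncated normal moment. *)
have := (hq n).2 m%:R e m0 e0.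
move: Jm3 Km Hn; rewrite sub0r normrN !ler_norml.
by move=> /andP[? ?] ? /andP[? ?] /andP[? ?]; apply/andP; rewrite /=; split; lra.
Unshelve. all: by end_near. Qed.
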